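(* Let $n$ be a positive integer, and let $\mathcal{GX}_{\mathbb{C}}$, $\mathcal{GY}_{\mathbb{C}}\subset\mathcal{GX}_{\mathbb{C}}$ and the complex Legendre involution $\mathcal{L}_{\mathbb{C}}:\mathcal{GX}_{\mathbb{C}}\to\mathcal{GX}_{\mathbb{C}}$ be as defined in the context. Assume a transform (i.e. a map of sets) $\mathcal{T}_{\mathbb{C}}:\mathcal{GX}_{\mathbb{C}}\to\mathcal{GX}_{\mathbb{C}}$ satisfies: (1) $\mathcal{T}_{\mathbb{C}}\circ\mathcal{T}_{\mathbb{C}}(\Phi)=\Phi$ for any $\Phi\in\mathcal{GX}_{\mathbb{C}}$; (2) for any $\Phi\in\mathcal{GX}_{\mathbb{C}}$, $\mathcal{T}_{\mathbb{C}}(\Phi)=\Phi$ if $\Phi\in\mathcal{GY}_{\mathbb{C}}$, and $\mathcal{T}_{\mathbb{C}}(\Phi)\neq\Phi$ if $\Phi\notin\mathcal{GY}_{\mathbb{C}}$. Assume moreover that there exists a holomorphic mapping $F:\mathbb{C}^{2n+1}\to\mathbb{C}^{2n+1}$ satisfying $\mathcal{T}_{\mathbb{C}}(\Phi)=F\circ\Phi$ for any $\Phi\in\mathcal{GX}_{\mathbb{C}}$. Then $\mathcal{T}_{\mathbb{C}}$ is the complex Legendre involution, i.e. $\mathcal{T}_{\mathbb{C}}(\Phi)=\mathcal{L}_{\mathbb{C}}(\Phi)$ for every $\Phi\in\mathcal{GX}_{\mathbb{C}}$.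
   Context: For a holomorphic mapping $\theta=(\theta_1,\ldots,\theta_n):\mathbb{C}^n\to\mathbb{C}^n$, let $Reg(\theta)\subset\mathbb{C}^n$ denote the set of regular points of $\theta$, i.e. the points at which the complex differential of $\theta$ is invertible. $\mathcal{GX}_{\mathbb{C}}$ is the set of all holomorphic mappings $\Phi=\big((\theta_1,\ldots,\theta_n),\,a,\,(b_1,\ldots,b_n)\big):\mathbb{C}^n\to\mathbb{C}^{2n+1}$ such that, writing $\theta=(\theta_1,\ldots,\theta_n)$ and $b=(b_1,\ldots,b_n)$: (i) the creative condition $da=\sum_{i=1}^n b_i\,d\theta_i$ holds as an equality of (holomorphic) one-forms on $\mathbb{C}^n$; (ii) both $Reg(\theta)$ and $Reg(b)$ are dense in $\mathbb{C}^n$. $\mathcal{GY}_{\mathbb{C}}$ is the subset of $\mathcal{GX}_{\mathbb{C}}$ consisting of all holomorphic mappings $\mathbb{C}^n\to\mathbb{C}^{2n+1}$ of the form $\big((\theta_1,\ldots,\theta_n),\,\tfrac12\sum_{i=1}^n\theta_i^2,\,(\theta_1,\ldots,\theta_n)\big)$ with $Reg(\theta)$ dense in $\mathbb{C}^n$. The complex Legendre involution $\mathcal{L}_{\mathbb{C}}:\mathcal{GX}_{\mathbb{C}}\to\mathcal{GX}_{\mathbb{C}}$ is the map $$\mathcal{L}_{\mathbb{C}}\big((\theta_1,\ldots,\theta_n),\,a,\,(b_1,\ldots,b_n)\big)=\Big((b_1,\ldots,b_n),\,\sum_{i=1}^n b_i\theta_i-a,\,(\theta_1,\ldots,\theta_n)\Big).$$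 *)

(* Defs.v *)
From HB Require Import structures.
From mathcomp Require Import all_boot all_order all_algebra.
From mathcomp Require Import all_classical all_reals all_analysis.
From mathcomp.real_closed Require Export complex.

Set Implicit Arguments.
Unset Strict Implicit.
Unset Printing Implicit Defensive.

Import Order.TTheory GRing.Theory Num.Theory.
Import numFieldNormedType.Exports.

Local Open Scope classical_set_scope.
Local Open Scope ring_scope.

(* The definitions make sense over any numeric field K; the complex case is   *)
(* K = R[i] with R : realType.  The normed module 'rV[K]_n is over the field  *)
(* K, so for K = R[i] [differentiable] and ['d] are complex Fréchet           *)
(* differentiability and the complex differential.                            *)

Section Holomorphic.
Context {K : numFieldType}.

Definition holomorphic {m k : nat} (f : 'rV[K]_m -> 'rV[K]_k) : Prop :=
  forall x, differentiable f x.

Definition Reg {n : nat} (f : 'rV[K]_n -> 'rV[K]_n) : set 'rV[K]_n :=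
  [set x | bijective ('d f x)].

End Holomorphic.

(* K^(2n+1) is 'rV[K]_(n + 1 + n), a vector being split as (theta, a, b).     *)
Section Coordinates.
Context {K : numFieldType} {n : nat}.

Definition triple (t : 'rV[K]_n) (a : K) (b : 'rV[K]_n) :
  'rV[K]_(n + 1 + n) := row_mx (row_mx t a%:M) b.

Implicit Type Phi : 'rV[K]_n -> 'rV[K]_(n + 1 + n).

Definition theta_part Phi (x : 'rV[K]_n) : 'rV[K]_n :=
  lsubmx (lsubmx (Phi x)).

Definition a_part Phi (x : 'rV[K]_n) : K :=
  rsubmx (lsubmx (Phi x)) ord0 ord0.

Definition b_part Phi (x : 'rV[K]_n) : 'rV[K]_n := rsubmx (Phi x).

Definition coordf (f : 'rV[K]_n -> 'rV[K]_n) (i : 'I_n)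
  (x : 'rV[K]_n) : K := f x ord0 i.

(* da = \sum_i b_i d(theta_i), evaluated at each point x and tangent vector v *)
Definition creative Phi : Prop :=
  forall x v : 'rV[K]_n,
    'd (a_part Phi) x v =
    \sum_(i < n) coordf (b_part Phi) i x * 'd (coordf (theta_part Phi) i) x v.

End Coordinates.

Section Spaces.
Variables (K : numFieldType) (n : nat).

Definition GX : set ('rV[K]_n -> 'rV[K]_(n + 1 + n)) :=
  [set Phi | [/\ holomorphic Phi, creative Phi,
                 dense (Reg (theta_part Phi)) & dense (Reg (b_part Phi))]].

Definition GY : set ('rV[K]_n -> 'rV[K]_(n + 1 + n)) :=
  [set Phi | holomorphic Phi /\
     exists t : 'rV[K]_n -> 'rV[K]_n,
       dense (Reg t) /\
       Phi = fun x => triple (t x) (2^-1 * \sum_(i < n) t x ord0 i ^+ 2) (t x)].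

Definition legendre_map (Phi : 'rV[K]_n -> 'rV[K]_(n + 1 + n)) :
    'rV[K]_n -> 'rV[K]_(n + 1 + n) :=
  fun x => triple
    (b_part Phi x)
    (\sum_(i < n) coordf (b_part Phi) i x * coordf (theta_part Phi) i x
       - a_part Phi x)
    (theta_part Phi x).

End Spaces.

Arguments GX K n : clear implicits.
Arguments GY K n : clear implicits.

Section Triple.
Context {K : numFieldType} {n : nat}.
Variables (t b : 'rV[K]_n -> 'rV[K]_n) (a : 'rV[K]_n -> K).
Let Phi x := triple (t x) (a x) (b x).

Lemma theta_part_triple : theta_part Phi = t.
Proof. by apply/funext => x; rewrite /theta_part /Phi /triple !row_mxKl. Qed.

Lemma a_part_triple : a_part Phi = a.
Proof.
by apply/funext => x; rewrite /a_part /Phi /triple row_mxKl row_mxKr mxE eqxx.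
Qed.

Lemma b_part_triple : b_part Phi = b.
Proof. by apply/funext => x; rewrite /b_part /Phi /triple row_mxKr. Qed.

End Triple.

Section Stability.
Context {K : numFieldType}.

Lemma diff_sum_apply (V : normedModType K) m (f : 'I_m -> V -> K) (x v : V) :
  (forall i, differentiable (f i) x) ->
  'd (\sum_(i < m) f i) x v = \sum_(i < m) 'd (f i) x v.
Proof.
move=> df; rewrite -deriveE; last exact: differentiable_sum.
rewrite derive_sum; last by move=> i; exact/diff_derivable/df.
by apply: eq_bigr => i _; rewrite deriveE.
Qed.

Lemma diffM_apply (V : normedModType K) (f g : V -> K) (x v : V) :
  differentiable f x -> differentiable g x ->
  'd (f * g) x v = f x * 'd g x v + g x * 'd f x v.
Proof. by move=> df dg; rewrite diffM. Qed.

Lemma diffB_apply (V : normedModType K) (f g : V -> K) (x v : V) :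
  differentiable f x -> differentiable g x ->
  'd (f \- g) x v = 'd f x v - 'd g x v.
Proof. by move=> df dg; rewrite diffB. Qed.

Lemma diffZ_apply (V : normedModType K) (f : V -> K) (k : K) (x v : V) :
  differentiable f x -> 'd (k *: f) x v = k * 'd f x v.
Proof. by move=> df; rewrite diffZ. Qed.

Lemma differentiable_entry m k (f : 'rV[K]_m -> 'rV[K]_k) j x :
  differentiable f x -> differentiable (fun y => f y ord0 j : K) x.
Proof.
by move=> df; exact: (differentiable_comp df (differentiable_coord _ _ _)).
Qed.

Lemma differentiable_row m k (f : 'rV[K]_m -> 'rV[K]_k) x :
  (forall j, differentiable (fun y => f y ord0 j : K) x) ->
  differentiable f x.
Proof.
move=> df.
have -> : f = \sum_(j < k) (fun y => f y ord0 j *: delta_mx ord0 j).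
  by apply/funext => y; rewrite fct_sumE -row_sum_delta.
by apply: differentiable_sum => j; exact: differentiableZl.
Qed.

Lemma holomorphic_triple n (t b : 'rV[K]_n -> 'rV[K]_n)
    (a : 'rV[K]_n -> K) :
  holomorphic t -> (forall x, differentiable a x) -> holomorphic b ->
  holomorphic (fun x => triple (t x) (a x) (b x)).
Proof.
move=> ht ha hb x; apply: differentiable_row => j; rewrite /triple.
case: (split_ordP j) => [k ->|k ->]; last first.
  under eq_fun do rewrite row_mxEr; exact: differentiable_entry.
under eq_fun do rewrite row_mxEl.
case: (split_ordP k) => [l ->|l ->].
  under eq_fun do rewrite row_mxEl; exact: differentiable_entry.
under eq_fun do rewrite row_mxEr !ord1 mxE eqxx mulr1n; exact: ha.
Qed.

Variable n : nat.
Implicit Type Phi : 'rV[K]_n -> 'rV[K]_(n + 1 + n).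

Lemma holomorphic_theta Phi : holomorphic Phi -> holomorphic (theta_part Phi).
Proof.
move=> hP x; apply: differentiable_row => j.
under eq_fun do rewrite /theta_part !mxE; exact: differentiable_entry.
Qed.

Lemma holomorphic_b Phi : holomorphic Phi -> holomorphic (b_part Phi).
Proof.
move=> hP x; apply: differentiable_row => j.
under eq_fun do rewrite /b_part !mxE; exact: differentiable_entry.
Qed.

Lemma differentiable_a Phi x : holomorphic Phi -> differentiable (a_part Phi) x.
Proof.
move=> hP; rewrite /a_part.
under eq_fun do rewrite !mxE; exact: differentiable_entry.
Qed.

Lemma differentiable_coordf (f : 'rV[K]_n -> 'rV[K]_n) i x :
  holomorphic f -> differentiable (coordf f i) x.
Proof. by move=> hf; exact: differentiable_entry. Qed.

Lemma legendre_map_GX Phi : GX K n Phi -> GX K n (legendre_map Phi).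
Proof.
move=> [hP cP dt db].
have ht := holomorphic_theta hP; have hb := holomorphic_b hP.
have dM i x : differentiable
    (coordf (b_part Phi) i * coordf (theta_part Phi) i) x.
  by apply: differentiableM; exact: differentiable_coordf.
have dS x : differentiable
    (\sum_(i < n) (coordf (b_part Phi) i * coordf (theta_part Phi) i)) x.
  by apply: differentiable_sum => i; exact: dM.
have aE : (fun x => \sum_(i < n) coordf (b_part Phi) i x *
      coordf (theta_part Phi) i x - a_part Phi x) =
    \sum_(i < n) (coordf (b_part Phi) i * coordf (theta_part Phi) i)
      \- a_part Phi.
  by apply/funext => x /=; rewrite fct_sumE.
rewrite /legendre_map; split.
- apply: holomorphic_triple => // x; rewrite aE.
  by apply: differentiableB => //; exact: differentiable_a.
- move=> x v; rewrite /creative theta_part_triple a_part_triple b_part_triple.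
  rewrite aE.
  rewrite (diffB_apply v (dS x) (differentiable_a x hP)) cP.
  rewrite (diff_sum_apply v (fun i => dM i x)) -sumrB; apply: eq_bigr => i _.
  rewrite (diffM_apply v (differentiable_coordf i x hb)
    (differentiable_coordf i x ht)).
  by rewrite addrAC subrr add0r.
- by rewrite theta_part_triple.
- by rewrite b_part_triple.
Qed.

Lemma GY_sub_GX : GY K n `<=` GX K n.
Proof.
move=> Phi [hP [t [rt PE]]].
pose a (x : 'rV[K]_n) : K := 2^-1 * \sum_(i < n) t x ord0 i ^+ 2.
have tE : theta_part Phi = t by rewrite PE (theta_part_triple t t a).
have aE : a_part Phi = a by rewrite PE (a_part_triple t t a).
have bE : b_part Phi = t by rewrite PE (b_part_triple t t a).
have ht : holomorphic t by rewrite -tE; exact: holomorphic_theta.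
split; rewrite ?tE ?bE// => x v; rewrite /creative tE aE bE.
have dt i := differentiable_coordf i x ht.
have dX i : differentiable (coordf t i * coordf t i) x.
  exact: differentiableM.
have -> : a = 2^-1 *: \sum_(i < n) (coordf t i * coordf t i).
  apply/funext => y; rewrite /a -[RHS]/(2^-1 * _ y) fct_sumE.
  by congr (_ * _); apply: eq_bigr => i _; rewrite expr2.
have dS : differentiable (\sum_(i < n) (coordf t i * coordf t i)) x.
  exact: differentiable_sum.
rewrite (diffZ_apply _ v dS) (diff_sum_apply v dX) mulr_sumr.
apply: eq_bigr => i _; rewrite (diffM_apply v (dt i) (dt i)).
by rewrite -mulr2n mulrnAr -mulrnAl -mulr_natr mulVf ?mul1r// pnatr_eq0.
Qed.

End Stability.

Definition legendre (K : numFieldType) (n : nat) (Phi : GX K n) : GX K n :=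
  exist _ (legendre_map (\val Phi))
    (mem_set (legendre_map_GX (set_valP Phi))).

(* Main.v *)
Require Import Defs.
From mathcomp Require Import all_boot all_order all_algebra.
From mathcomp Require Import all_classical all_reals all_analysis.
From mathcomp Require Import ring lra zify.

Set Implicit Arguments.
Unset Strict Implicit.
Unset Printing Implicit Defensive.

Import Order.TTheory GRing.Theory Num.Theory.
Import numFieldNormedType.Exports.
Import Normc.

Local Open Scope classical_set_scope.
Local Open Scope ring_scope.
Local Open Scope complex_scope.

(* A holomorphic F with T Phi = F o Phi is an involution, fixes the graph
   Y = {(t, t.t/2, t)} pointwise and preserves the contact distribution
   da = b.dtheta, since quadratic test maps in GX pass through every contact
   direction at every point.  F also preserves the complement of GX: applied to
   quadratic maps whose theta-part (or b-part) is nowhere regular, this gives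
   det(A + S B) det(C + S D) = 0 for all singular symmetric S, where A, B, C, D
   are the blocks of dF on the contact distribution, and one factor must vanish
   identically.  Linear algebra then forces dF either to preserve or to exchange
   the two Legendrian foliations {theta, a constant} and {b, b.theta - a constant}.
   So F, respectively the Legendre map composed with F, preserves both foliations;
   as it fixes Y it is the identity.  The first case contradicts T Phi <> Phi for
   Phi outside GY.

   The needed rigidity of entire functions is obtained from Goursat's lemma: a
   crude Cauchy bound on squares, sharpened by taking powers, replaces power
   series; differentiability of derivatives is read off bounds on second divided
   differences, which survive pointwise limits. *)

(** Membership in [GX] concerns a whole map, while information on F is wanted at a single point. Two
    facts bridge the gap. A Jacobian determinant is entire along lines, so one regular point already
    gives a dense set of them. And F o F = id: if F o Psi lies in GX, then so does Psi = F o (F o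
    Psi), so a test map with a nowhere regular part cannot be sent to a map both of whose parts have
    a regular point. Tangent planes spanned by (1, S) give A = 0 or C = 0, those spanned by (S, 1)
    give B = 0 or D = 0; as dF is onto on contact hyperplanes, A = B = 0 and C = D = 0 are
    impossible, and the two announced cases remain.

    On the analytic side only inequalities are extracted from contour integrals: the imaginary part
    of the integral of m/(z - p) is bounded below by 4m instead of being evaluated as 2 pi m, and
    the lost constant disappears on taking n-th roots. A directional derivative is a pointwise limit
    of entire difference quotients; an inequality between values at three points passes to such a
    limit without any uniformity. *)

Section ComplexBasics.
Variable R : realType.
Local Notation C := (Num.NumField.sort (complex R : numFieldType)).
Implicit Types (z w : C) (f g : C -> C).

Lemma normC_normc z : `|z| = (normc z)%:C.
Proof. by rewrite normc_def; case: z. Qed.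

Lemma normc_ge0 z : 0 <= normc z.
Proof. by case: z => x y /=; exact: sqrtr_ge0. Qed.

Lemma normc_gt0 z : (0 < normc z) = (z != 0).
Proof.
rewrite lt_def normc_ge0 andbT; apply/idP/idP; apply: contraNN => /eqP.
  by move=> ->; rewrite normc0.
by move/eq0_normc => ->.
Qed.

Lemma normcX z n : normc (z ^+ n) = normc z ^+ n.
Proof. by elim: n => [|n IH]; rewrite ?expr0 ?normc1// !exprS normcM IH. Qed.

Lemma normc_realE (x : R) : normc x%:C = `|x|.
Proof. by rewrite /= expr0n /= addr0 sqrtr_sqr. Qed.

Lemma normc_distC z w : normc (z - w) = normc (w - z).
Proof. by rewrite -normcN opprB. Qed.

Lemma normcB z w : normc (z - w) <= normc z + normc w.
Proof. by rewrite -(normcN w); exact: le_normcD. Qed.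

Lemma normc_subr_ge z w : normc z - normc w <= normc (z - w).
Proof. by rewrite lerBlDr -{1}(subrK w z); exact: le_normcD. Qed.

Lemma Re_le_normc z : `|complex.Re z| <= normc z.
Proof. by have := normc_ge_Re z; rewrite normC_normc lecR. Qed.

Lemma Im_le_normc z : `|complex.Im z| <= normc z.
Proof.
have -> : complex.Im z = complex.Re (- 'i * z) by case: z => x y /=; lra.
by apply: le_trans (Re_le_normc _) _; rewrite normcM normcN /= expr0n expr1n add0r sqrtr1 mul1r.
Qed.

Lemma normc_le_ReIm z : normc z <= `|complex.Re z| + `|complex.Im z|.
Proof.
rewrite {1}(complexE z); apply: le_trans (le_normcD _ _) _.
rewrite normcM !normc_realE lerD2l /= expr0n expr1n add0r sqrtr1 mul1r //.
Qed.

Lemma ReB z w : complex.Re (z - w) = complex.Re z - complex.Re w.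
Proof. by case: z; case: w. Qed.

Lemma ImB z w : complex.Im (z - w) = complex.Im z - complex.Im w.
Proof. by case: z; case: w. Qed.

Lemma gtc0_real (e : C) : 0 < e -> exists2 r : R, 0 < r & e = r%:C.
Proof. by case: e => x y; rewrite ltcE /= => /andP[/eqP -> x0]; exists x. Qed.

Lemma nbhs_normc (p : C) (P : set C) :
  nbhs p P <-> exists2 d : R, 0 < d & forall z, normc (z - p) < d -> P z.
Proof.
split=> [/nbhs_normP[e /= e0 He]|[d d0 Hd]].
  have := e0; rewrite ltcE /= => /andP[/eqP Ie Re0].
  exists (complex.Re e) => // z zp; apply: He => /=.
  by rewrite -normrN opprB normC_normc ltcE /= Ie eqxx.
apply/nbhs_normP; exists d%:C => /=; first by rewrite ltcR.
by move=> z /=; rewrite -normrN opprB normC_normc ltcR; exact: Hd.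
Qed.

(** Complex differentiability with real tolerances; the quotient is multiplied out, so z = p needs
    no exclusion. *)
Definition cderiv f (p b : C) := forall e : R, 0 < e ->
  exists2 d : R, 0 < d & forall z, normc (z - p) < d ->
    normc (f z - f p - b * (z - p)) <= e * normc (z - p).

Lemma continuous_normc f (p : C) : {for p, continuous f} ->
  forall e : R, 0 < e -> exists2 d : R, 0 < d & forall z, normc (z - p) < d ->
    normc (f z - f p) < e.
Proof.
move=> cf e e0.
have /cvgrPdist_lt/(_ e%:C) := cf; rewrite ltcR => /(_ e0) /nbhs_normc[d d0 Hd].
by exists d => // z /Hd; rewrite -normrN opprB normC_normc ltcR.
Qed.

Lemma normc_continuous f (p : C) :
  (forall e : R, 0 < e -> exists2 d : R, 0 < d & forall z, normc (z - p) < d ->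
    normc (f z - f p) < e) -> {for p, continuous f}.
Proof.
move=> H; apply/(@cvgrPdist_lt C C C (nbhs p) (nbhs_filter p)) => e.
rewrite ltcE /= => /andP[/eqP Ie /H[d d0 Hd]].
apply/nbhs_normc; exists d => // z /Hd.
by rewrite -normrN opprB normC_normc ltcE /= Ie eqxx.
Qed.

Lemma cderivP f (p b : C) : is_derive p 1 f b <-> cderiv f p b.
Proof.
have equiv (e : R) z : z != 0 ->
    (`|b - z^-1 *: ((f \o shift p) (z *: (1 : C)) - f p)| <= e%:C) =
    (normc (f (p + z) - f p - b * z) <= e * normc z).
  move=> z0; rewrite normC_normc lecR /= addrC.
  rewrite -[LHS](ler_pM2r (_ : 0 < normc z)) ?normc_gt0// -normcM.
  rewrite -[in LHS]normcN -[z^-1 *: _]/(z^-1 * _) mulrDl mulNr mulrC mulrA mulfV // mul1r.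
  rewrite -[z *: 1]/(z * 1) mulr1 [z + p]addrC.
  by congr (normc _ <= _); ring.
split=> [[df dE]|H].
  move=> e e0; have /cvgrPdist_le/(_ e%:C) := df.
  rewrite -[lim _]/('D_1 f p) dE ltcR => /(_ e0).
  rewrite /= => /nbhs_normc[d d0 Hd].
  exists d => // z zp; have [->|zp0] := eqVneq z p.
    by rewrite !subrr mulr0 subrr normc0 mulr0.
  have := Hd (z - p); rewrite subr0 subr_eq0 => /(_ zp zp0).
  by rewrite equiv ?subr_eq0// [p + _]addrC subrK.
suff cv : h^-1 *: ((f \o shift p) (h *: (1 : C)) - f p) @[h --> 0^'] --> b.
  by apply: DeriveDef; [apply/cvg_ex; exists b|exact: cvg_lim].
apply/cvgrPdist_le => e; rewrite ltcE /= => /andP[/eqP Ie /H[d d0 Hd]].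
apply/nbhs_normc; exists d => // z; rewrite subr0 => zd z0.
have -> : e = (complex.Re e)%:C by case: e Ie {Hd} => x y /= ->.
by rewrite equiv //; have := Hd (p + z); rewrite [p + z]addrC addrK; exact.
Qed.

Lemma cderiv_differentiable f p b : cderiv f p b -> differentiable f p.
Proof. by move=> /cderivP[df _]; exact/derivable1_diffP. Qed.

Lemma differentiable_cderiv f p : differentiable f p -> exists b, cderiv f p b.
Proof.
by move=> /derivable1_diffP df; exists ('D_1 f p); apply/cderivP; exact: DeriveDef.
Qed.

Definition entire f := forall z, differentiable f z.

Lemma entire_cst (k : C) : entire (fun=> k).
Proof. by move=> z; exact: differentiable_cst. Qed.

Lemma entire_id : entire (fun z => z).
Proof. by move=> z; apply/derivable1_diffP; exact: derivable_id. Qed.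

Lemma entireD f g : entire f -> entire g -> entire (fun z => f z + g z).
Proof. by move=> ef eg z; exact: differentiableD. Qed.

Lemma entireB f g : entire f -> entire g -> entire (fun z => f z - g z).
Proof. by move=> ef eg z; exact: differentiableB. Qed.

Lemma entireM f g : entire f -> entire g -> entire (fun z => f z * g z).
Proof. by move=> ef eg z; exact: differentiableM. Qed.

Lemma differentiable_powX f n z : differentiable f z ->
  differentiable (fun u => f u ^+ n) z.
Proof.
move=> df; elim: n => [|n IH].
  by rewrite (_ : (fun u => _) = fun=> 1) //; exact: differentiable_cst.
rewrite (_ : (fun u => _) = f * (fun u => f u ^+ n)); first exact: differentiableM.
by apply/funext => u; rewrite exprS.
Qed.

Lemma entireX f n : entire f -> entire (fun z => f z ^+ n).
Proof.
by move=> ef z; exact: differentiable_powX.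
Qed.

Lemma entire_continuous f : entire f -> continuous f.
Proof. by move=> ef z; apply: differentiable_continuous. Qed.

End ComplexBasics.

(** * Integrals of continuous real functions over segments *)

Section Segment.
Variable R : realType.
Implicit Types (f g : R -> R) (a b : R).

Definition seg_integral f a b : R := \int[@lebesgue_measure R]_(x in `[a, b]) f x.

Definition seg_cont f a b := forall x, a <= x <= b -> {for x, continuous f}.

Lemma seg_cont_integrable f a b : seg_cont f a b ->
  (@lebesgue_measure R).-integrable `[a, b] (EFin \o f).
Proof.
move=> cf; apply: continuous_compact_integrable; first exact: segment_compact.
apply: continuous_in_subspaceT => x; rewrite inE /= in_itv /=; exact: cf.
Qed.

Lemma seg_integral_split f a m b : a <= m -> m <= b -> seg_cont f a b ->
  seg_integral f a b = seg_integral f a m + seg_integral f m b.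
Proof.
move=> am mb cf; have If := seg_cont_integrable cf.
have := @Rintegral_itvB R f (BLeft a) (BRight b) m If.
rewrite !bnd_simp => /(_ am mb); rewrite -/(seg_integral f a b) -/(seg_integral f a m).
rewrite Rintegral_itv_obnd_cbnd; last first.
  apply: integrableS If => // x /=; rewrite !in_itv /= => /andP[mx ->].
  by rewrite andbT (le_trans am) // ltW.
by rewrite -/(seg_integral f m b) => <-; rewrite addrC subrK.
Qed.

Lemma seg_integral_cst (k a b : R) : a <= b -> seg_integral (fun=> k) a b = k * (b - a).
Proof.
move=> ab; rewrite /seg_integral Rintegral_cst //= lebesgue_measure_itv /= lte_fin.
by case: ltgtP ab => // -> _; rewrite subrr.
Qed.

Lemma seg_integralB f g a b : seg_cont f a b -> seg_cont g a b ->
  seg_integral (fun x => f x - g x) a b = seg_integral f a b - seg_integral g a b.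
Proof. by move=> cf cg; rewrite /seg_integral RintegralB//; exact: seg_cont_integrable. Qed.

Lemma le_seg_integral f g a b : seg_cont f a b -> seg_cont g a b ->
  (forall x, a <= x <= b -> f x <= g x) -> seg_integral f a b <= seg_integral g a b.
Proof.
by move=> cf cg fg; apply: le_Rintegral => //; exact: seg_cont_integrable.
Qed.

Lemma seg_cont_cst (k a b : R) : seg_cont (fun=> k) a b.
Proof. by move=> x _; exact: cst_continuous. Qed.

Lemma seg_integral_le f a b (M : R) : a <= b -> seg_cont f a b ->
  (forall x, a <= x <= b -> `|f x| <= M) -> `|seg_integral f a b| <= M * (b - a).
Proof.
move=> ab cf fM; rewrite ler_norml -mulNr -!seg_integral_cst //; apply/andP.
by split; apply: le_seg_integral => //; try exact: seg_cont_cst; move=> x /fM;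
  rewrite ler_norml => /andP[].
Qed.

End Segment.

(** * Contour integrals along rectangles *)

Section Goursat.
Variable R : realType.
Local Notation C := (Num.NumField.sort (complex R : numFieldType)).
Implicit Types (f g : C -> C) (a b c d : R).

(** With dz = dx + i dy one has Im (f dz) = Im f dx + Re f dy, hence Im on horizontal sides and Re
    on vertical ones. The imaginary part suffices because the value to be bounded is later rotated
    to a nonnegative real, and a simple pole with real residue contributes a purely imaginary
    integral. *)
Definition horiz_integral f a b (y : R) := seg_integral (fun x => complex.Im (f (x +i* y))) a b.
Definition vert_integral f c d (x : R) := seg_integral (fun y => complex.Re (f (x +i* y))) c d.

(* The imaginary part of the integral of f dz along the boundary. *)
Definition rect_integral f a b c d :=
  horiz_integral f a b c - horiz_integral f a b d + (vert_integral f c d b - vert_integral f c d a).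

Definition in_rect a b c d (z : C) :=
  (a <= complex.Re z <= b) && (c <= complex.Im z <= d).

Definition rect_cont f a b c d :=
  forall z, in_rect a b c d z -> {for z, continuous f}.

Lemma rect_contS f a b c d a' b' c' d' : rect_cont f a b c d ->
  a <= a' -> b' <= b -> c <= c' -> d' <= d -> rect_cont f a' b' c' d'.
Proof.
move=> cf aa bb cc dd z /andP[/andP[az zb] /andP[cz zd]]; apply: cf.
by rewrite /in_rect; lra.
Qed.

Lemma continuous_Im_horizontal f (x y : R) : {for x +i* y, continuous f} ->
  {for x, continuous (fun t : R => complex.Im (f (t +i* y)) : R)}.
Proof.
move=> /continuous_normc cf; apply/(@cvgrPdist_lt R R R (nbhs x) (nbhs_filter x)).
move=> e e0; have [d d0 Hd] := cf _ e0.
apply/nbhs_normP; exists d => //= t xt.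
apply: le_lt_trans (Hd (t +i* y) _); last first.
  by rewrite -[_ - _]/((t - x) +i* (y - y)) subrr normc_realE distrC.
by rewrite distrC; apply: le_trans (Im_le_normc _); case: (f _); case: (f _).
Qed.

Lemma continuous_Re_vertical f (x y : R) : {for x +i* y, continuous f} ->
  {for y, continuous (fun t : R => complex.Re (f (x +i* t)) : R)}.
Proof.
move=> /continuous_normc cf; apply/(@cvgrPdist_lt R R R (nbhs y) (nbhs_filter y)).
move=> e e0; have [d d0 Hd] := cf _ e0.
apply/nbhs_normP; exists d => //= t yt.
apply: le_lt_trans (Hd (x +i* t) _); last first.
  rewrite -[_ - _]/((x - x) +i* (t - y)) subrr /= expr0n add0r sqrtr_sqr.
  by rewrite distrC.
by rewrite distrC; apply: le_trans (Re_le_normc _); case: (f _); case: (f _).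
Qed.

(** Continuity is asked on the boundary only, so that integrands with a pole inside the rectangle
    are allowed. *)
Definition in_frame a b c d (z : C) := in_rect a b c d z /\
  [\/ complex.Re z = a, complex.Re z = b, complex.Im z = c | complex.Im z = d].

Definition frame_cont f a b c d :=
  forall z, in_frame a b c d z -> {for z, continuous f}.

Lemma rect_cont_fcont f a b c d : rect_cont f a b c d -> frame_cont f a b c d.
Proof. by move=> cf z [hz _]; exact: cf. Qed.

Lemma in_frame_h a b c d x y : c <= d -> y = c \/ y = d -> a <= x <= b ->
  in_frame a b c d (x +i* y).
Proof.
move=> cd yE xab; rewrite /in_frame /in_rect /= xab.
by split; [case: yE => ->; lra|case: yE => ->; [apply: Or43|apply: Or44]].
Qed.

Lemma in_frame_v a b c d x y : a <= b -> x = a \/ x = b -> c <= y <= d ->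
  in_frame a b c d (x +i* y).
Proof.
move=> ab xE ycd; rewrite /in_frame /in_rect /= ycd andbT.
by split; [case: xE => ->; lra|case: xE => ->; [apply: Or41|apply: Or42]].
Qed.

Lemma frame_cont_h f a b c d y : c <= d -> frame_cont f a b c d -> y = c \/ y = d ->
  seg_cont (fun x => complex.Im (f (x +i* y))) a b.
Proof.
move=> cd cf yE x xab; apply: continuous_Im_horizontal; apply: cf.
exact: in_frame_h.
Qed.

Lemma frame_cont_v f a b c d x : a <= b -> frame_cont f a b c d -> x = a \/ x = b ->
  seg_cont (fun y => complex.Re (f (x +i* y))) c d.
Proof.
move=> ab cf xE y ycd; apply: continuous_Re_vertical; apply: cf.
exact: in_frame_v.
Qed.

Lemma rect_integral_splitx f a m b c d : a <= m -> m <= b -> c <= d ->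
  frame_cont f a b c d -> rect_integral f a b c d = rect_integral f a m c d + rect_integral f m b c d.
Proof.
move=> am mb cd cf; rewrite /rect_integral /horiz_integral.
rewrite (seg_integral_split am mb (frame_cont_h cd cf (or_introl erefl))).
rewrite (seg_integral_split am mb (frame_cont_h cd cf (or_intror erefl))).
by ring.
Qed.

Lemma rect_integral_splity f a b c m d : a <= b -> c <= m -> m <= d ->
  frame_cont f a b c d -> rect_integral f a b c d = rect_integral f a b c m + rect_integral f a b m d.
Proof.
move=> ab cm md cf; rewrite /rect_integral /vert_integral.
rewrite (seg_integral_split cm md (frame_cont_v ab cf (or_introl erefl))).
rewrite (seg_integral_split cm md (frame_cont_v ab cf (or_intror erefl))).
by ring.
Qed.

Lemma rect_integralB f g a b c d : a <= b -> c <= d ->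
  frame_cont f a b c d -> frame_cont g a b c d ->
  rect_integral (fun z => f z - g z) a b c d = rect_integral f a b c d - rect_integral g a b c d.
Proof.
move=> ab cd cf cg; rewrite /rect_integral /horiz_integral /vert_integral.
under [seg_integral _ a b]eq_Rintegral do rewrite ImB.
under [X in _ - X + _]eq_Rintegral do rewrite ImB.
under [X in _ + (X - _)]eq_Rintegral do rewrite ReB.
under [X in _ + (_ - X)]eq_Rintegral do rewrite ReB.
have h y (yE : y = c \/ y = d) := seg_integralB (frame_cont_h cd cf yE) (frame_cont_h cd cg yE).
have v x (xE : x = a \/ x = b) := seg_integralB (frame_cont_v ab cf xE) (frame_cont_v ab cg xE).
rewrite -!/(seg_integral _ _ _) !h ?v; try by [left|right].
by ring.
Qed.

Lemma rect_integral_le f a b c d (M : R) : a <= b -> c <= d -> frame_cont f a b c d ->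
  (forall z, in_frame a b c d z -> normc (f z) <= M) ->
  `|rect_integral f a b c d| <= M * (2 * (b - a) + 2 * (d - c)).
Proof.
move=> ab cd cf fM.
have h y (yE : y = c \/ y = d) : `|horiz_integral f a b y| <= M * (b - a).
  apply: seg_integral_le => //; first exact: frame_cont_h cd cf yE.
  by move=> x xb; apply: le_trans (Im_le_normc _) (fM _ _); exact: in_frame_h.
have v x (xE : x = a \/ x = b) : `|vert_integral f c d x| <= M * (d - c).
  apply: seg_integral_le => //; first exact: frame_cont_v ab cf xE.
  by move=> y yd; apply: le_trans (Re_le_normc _) (fM _ _); exact: in_frame_v.
rewrite /rect_integral; apply: le_trans (ler_normD _ _) _.
apply: le_trans (lerD (ler_normB _ _) (ler_normB _ _)) _.
have := (h _ (or_introl erefl), h _ (or_intror erefl),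
  (v _ (or_introl erefl), v _ (or_intror erefl))) => -[[h1 h2] [h3 h4]].
lra.
Qed.

(** On opposite sides the integrands differ by constants, Re w (c - d) and Re w (b - a); multiplied
    by the side lengths, the two contributions cancel. No primitive is involved. *)
Lemma rect_integral_affine (u p w : C) a b c d : a <= b -> c <= d ->
  rect_integral (fun z => u + w * (z - p)) a b c d = 0.
Proof.
move=> ab cd; rewrite /rect_integral /horiz_integral /vert_integral.
have cont : frame_cont (fun z => u + w * (z - p)) a b c d.
  move=> z _; apply: entire_continuous; apply: entireD; first exact: entire_cst.
  apply: entireM; first exact: entire_cst.
  by apply: entireB; [exact: entire_id|exact: entire_cst].
rewrite -(seg_integralB (frame_cont_h cd cont (or_introl erefl))
  (frame_cont_h cd cont (or_intror erefl))).
rewrite -(seg_integralB (frame_cont_v ab cont (or_intror erefl))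
  (frame_cont_v ab cont (or_introl erefl))).
case: u w p {cont} => [u1 u2] [w1 w2] [p1 p2].
rewrite /seg_integral.
under eq_Rintegral => x _.
  rewrite (_ : _ - _ = w1 * (c - d)); last by simpc => /=; ring.
  over.
under [X in _ + X]eq_Rintegral => x _.
  rewrite (_ : _ - _ = w1 * (b - a)); last by simpc => /=; ring.
  over.
by rewrite -!/(seg_integral (fun=> _) _ _) !seg_integral_cst //; ring.
Qed.

End Goursat.

(** * Goursat's lemma by repeated quartering *)

Section GoursatThm.
Variable R : realType.
Local Notation C := (Num.NumField.sort (complex R : numFieldType)).
Implicit Types (f g : C -> C) (a b c d : R).

(** The four quarters add up to the whole, so one carries at least a quarter of the absolute value.
    Of its corner [s] only a range is recorded, which is all that nesting needs. *)
Lemma rect_integral_quarter f x y w h : 0 <= w -> 0 <= h ->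
  rect_cont f x (x + 2 * w) y (y + 2 * h) ->
  exists s : R * R, [/\ x <= s.1 <= x + w, y <= s.2 <= y + h &
    `|rect_integral f x (x + 2 * w) y (y + 2 * h)| <=
    4 * `|rect_integral f s.1 (s.1 + w) s.2 (s.2 + h)|].
Proof.
move=> w0 h0 cf; apply: contrapT => /forallNP H.
have {}H x' y' : x <= x' <= x + w -> y <= y' <= y + h ->
    4 * `|rect_integral f x' (x' + w) y' (y' + h)| <
    `|rect_integral f x (x + 2 * w) y (y + 2 * h)|.
  move=> hx hy; rewrite ltNge; apply/negP => hxy.
  by apply: (H (x', y')); split.
have hx1 : x <= x <= x + w by lra.
have hx2 : x <= x + w <= x + w by lra.
have hy1 : y <= y <= y + h by lra.
have hy2 : y <= y + h <= y + h by lra.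
have := (H _ _ hx1 hy1, H _ _ hx1 hy2, (H _ _ hx2 hy1, H _ _ hx2 hy2)).
rewrite (_ : x + w + w = x + 2 * w); last by ring.
rewrite (_ : y + h + h = y + 2 * h); last by ring.
have cxl : rect_cont f x (x + w) y (y + 2 * h) by apply: rect_contS cf _ _ _ _; lra.
have cxr : rect_cont f (x + w) (x + 2 * w) y (y + 2 * h).
  by apply: rect_contS cf _ _ _ _; lra.
have -> := rect_integral_splitx (_ : x <= x + w) (_ : x + w <= x + 2 * w) (_ : y <= y + 2 * h)
  (rect_cont_fcont cf);
  try lra.
have -> := rect_integral_splity (_ : x <= x + w) (_ : y <= y + h) (_ : y + h <= y + 2 * h)
  (rect_cont_fcont cxl);
  try lra.
have -> := rect_integral_splity (_ : x + w <= x + 2 * w) (_ : y <= y + h)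
  (_ : y + h <= y + 2 * h) (rect_cont_fcont cxr); try lra.
set i1 := rect_integral _ _ _ _ _; set i2 := rect_integral _ _ _ _ _.
set i3 := rect_integral _ _ _ _ _; set i4 := rect_integral _ _ _ _ _.
move=> [[h1 h2] [h3 h4]].
have := ler_normD (i1 + i2) (i3 + i4).
have := (ler_normD i1 i2, ler_normD i3 i4) => -[n1 n2] n3.
lra.
Qed.

Lemma goursat f a b c d : a <= b -> c <= d ->
  (forall z, in_rect a b c d z -> differentiable f z) -> rect_integral f a b c d = 0.
Proof.
move=> ab cd df.
have cf : rect_cont f a b c d.
  by move=> z /df; exact: differentiable_continuous.
pose w (k : nat) : R := (b - a) / 2 ^+ k; pose h (k : nat) : R := (d - c) / 2 ^+ k.
have p2 k : (0 : R) < 2 ^+ k by rewrite exprn_gt0.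
have w0 k : 0 <= w k by rewrite divr_ge0 ?subr_ge0 // ltW.
have h0 k : 0 <= h k by rewrite divr_ge0 ?subr_ge0 // ltW.
have wS k : w k = 2 * w k.+1.
  by rewrite /w exprS; field; rewrite gt_eqF ?p2.
have hS k : h k = 2 * h k.+1.
  by rewrite /h exprS; field; rewrite gt_eqF ?p2.
(* [s] is the lower left corner of the rectangle of level k, whose sides [w k] and [h k] are 2^k
   times smaller. *)
pose inv k (s : R * R) := [/\ a <= s.1, s.1 + w k <= b, c <= s.2,
  s.2 + h k <= d & `|rect_integral f a b c d| <=
    4 ^+ k * `|rect_integral f s.1 (s.1 + w k) s.2 (s.2 + h k)|].
pose nxt k (s s' : R * R) := [/\ inv k.+1 s', s.1 <= s'.1 <= s.1 + w k.+1 &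
  s.2 <= s'.2 <= s.2 + h k.+1].
have step k s : inv k s -> exists s', nxt k s s'.
  move=> [h1 h2 h3 h4 h5]; have := @rect_integral_quarter f s.1 s.2 (w k.+1) (h k.+1).
  rewrite -wS -hS => /(_ (w0 _) (h0 _) (rect_contS cf h1 h2 h3 h4)).
  move=> [s' [sx sy le4]]; exists s'; split => //.
  move: (wS k) (hS k) => wk hk; split; try lra.
  apply: le_trans h5 _; by rewrite exprSr -mulrA ler_wpM2l.
(* The default value of [xget] never occurs, since [step] provides a successor under the
   invariant. *)
pose s := fix s k := if k is k'.+1 then xget (s k') [set s' | nxt k' (s k') s']
  else (a, c).
have invs k : inv k (s k).
  elim: k => [|k IH]; last by case: (xgetPex (s k) (step k _ IH)).
  rewrite /inv /w /h !expr0 !divr1 mul1r /= [a + _]addrC [c + _]addrC !subrK.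
  by split; exact: lexx.
have nxts k : nxt k (s k) (s k.+1) := xgetPex (s k) (step k _ (invs k)).
(* Subtracting [w (k + j)] keeps the right end of the later rectangle inside the earlier one as
   well. *)
have mono k j : (s k).1 <= (s (k + j)%N).1 <= (s k).1 + w k - w (k + j)%N /\
                (s k).2 <= (s (k + j)%N).2 <= (s k).2 + h k - h (k + j)%N.
  elim: j => [|j [IH1 IH2]]; first by rewrite addn0; split; lra.
  rewrite addnS; have [_ h1 h2] := nxts (k + j)%N.
  by move: (wS (k + j)%N) (hS (k + j)%N) => wk hk; split; lra.
have bnd k j : (s k).1 <= (s j).1 + w j /\ (s k).2 <= (s j).2 + h j.
  have [kj|/ltnW jk] := leqP k j.
    have := mono k (j - k)%N; rewrite subnKC // => -[m1 m2].
    by move: (w0 j) (h0 j) => *; split; lra.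
  have := mono j (k - j)%N; rewrite subnKC // => -[m1 m2].
  by move: (w0 k) (h0 k) => *; split; lra.
(* By [bnd] every left end lies below every right end, so the supremum of the left ends is common to
   all the rectangles. *)
pose p1 := sup (range (fun k => (s k).1)); pose p2' := sup (range (fun k => (s k).2)).
have p1P k : (s k).1 <= p1 <= (s k).1 + w k.
  apply/andP; split.
    apply: ub_le_sup; last by exists k.
    by exists ((s 0%N).1 + w 0%N) => _ [j _ <-]; case: (bnd j 0%N).
  by apply: ge_sup; [exists (s 0%N).1, 0%N|move=> _ [j _ <-]; case: (bnd j k)].
have p2P k : (s k).2 <= p2' <= (s k).2 + h k.
  apply/andP; split.
    apply: ub_le_sup; last by exists k.
    by exists ((s 0%N).2 + h 0%N) => _ [j _ <-]; case: (bnd j 0%N).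
  by apply: ge_sup; [exists (s 0%N).2, 0%N|move=> _ [j _ <-]; case: (bnd j k)].
pose p : C := p1 +i* p2'.
have [q fq] : exists q, cderiv f p q.
  apply: differentiable_cderiv; apply: df; rewrite /in_rect /=.
  by have [h1 h2 h3 h4 _] := invs 0%N; move: (p1P 0%N) (p2P 0%N) => *; lra.
pose D := (b - a) + (d - c).
have D0 : 0 <= D by rewrite /D; lra.
(* At level k the integrand is at most e D/2^k after removal of an affine part, and the perimeter is
   2 D/2^k; the factor 4^k of the invariant cancels the powers of 2. *)
suff main e : 0 < e -> `|rect_integral f a b c d| <= 2 * D ^+ 2 * e.
  apply/eqP; rewrite -normr_le0; apply/ler_addgt0Pl => e e0; rewrite addr0.
  have DD : 0 < 2 * D ^+ 2 + 1 by rewrite ltr_wpDl // mulr_ge0 // sqr_ge0.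
  apply: le_trans (main (e / (2 * D ^+ 2 + 1)) (divr_gt0 e0 DD)) _.
  rewrite mulrCA ger_pMr // ler_pdivrMr // mul1r; lra.
move=> e0; have [r r0 Hr] := fq _ e0.
have [k kr] : exists k, D / 2 ^+ k < r.
  exists (Num.truncn (D / r)).+1; rewrite ltr_pdivrMr //.
  rewrite -ltr_pdivrMl // mulrC; apply: lt_trans (truncnS_gt _) _.
  by rewrite -natrX ltr_nat ltn_expl.
have Dk : D / 2 ^+ k = w k + h k by rewrite /D mulrDl.
have [h1 h2 h3 h4 le4] := invs k.
have {}h2 : (s k).1 <= (s k).1 + w k by move: (w0 k) => *; lra.
have {}h4 : (s k).2 <= (s k).2 + h k by move: (h0 k) => *; lra.
(* The affine part of f at p integrates to 0, so it may be subtracted from f. *)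
pose g z := f p + q * (z - p).
have eg : rect_cont g (s k).1 ((s k).1 + w k) (s k).2 ((s k).2 + h k).
  move=> z _; apply: entire_continuous; apply: entireD; first exact: entire_cst.
  apply: entireM; first exact: entire_cst.
  by apply: entireB; [exact: entire_id|exact: entire_cst].
have ef : rect_cont f (s k).1 ((s k).1 + w k) (s k).2 ((s k).2 + h k).
  by have [? ? ? ? _] := invs k; apply: rect_contS cf _ _ _ _.
have := rect_integralB h2 h4 (rect_cont_fcont ef) (rect_cont_fcont eg); rewrite rect_integral_affine // subr0 => bE.
have : `|rect_integral f (s k).1 ((s k).1 + w k) (s k).2 ((s k).2 + h k)| <=
    (e * (D / 2 ^+ k)) * (2 * (D / 2 ^+ k)).
  have -> : 2 * (D / 2 ^+ k) = 2 * ((s k).1 + w k - (s k).1) +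
      2 * ((s k).2 + h k - (s k).2) by rewrite Dk; ring.
  rewrite -bE; apply: rect_integral_le => //.
  - by move=> z [hz _]; apply: continuousB; [exact: ef|exact: eg].
  - move=> z [/andP[hx hy] _].
    have zp : normc (z - p) <= D / 2 ^+ k.
      apply: le_trans (normc_le_ReIm _) _; rewrite Dk; apply: lerD.
        case: z hx {hy} => x y /=; rewrite ler_norml; move: (p1P k) => *; lra.
      case: z hy {hx} => x y /=; rewrite ler_norml; move: (p2P k) => *; lra.
    rewrite /g opprD addrA; apply: le_trans (Hr _ (le_lt_trans zp kr)) _.
    by rewrite ler_wpM2l // ltW.
move=> le5; apply: le_trans le4 _.
apply: le_trans (ler_wpM2l (exprn_ge0 _ _) le5) _ => //.
rewrite (_ : 4 = 2 * 2); last by ring.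
rewrite exprMn; rewrite le_eqVlt; apply/orP; left; apply/eqP; field.
by rewrite gt_eqF.
Qed.

End GoursatThm.

(** * A Cauchy estimate with a crude constant *)

Section CauchyBound.
Variable R : realType.
Local Notation C := (Num.NumField.sort (complex R : numFieldType)).
Implicit Types (f g : C -> C) (a b c d : R).

(** Cut along x = a' and x = b', then cut the middle column along y = c' and y = d'. The four pieces
    around the inner rectangle vanish by [goursat]. *)
Lemma rect_integral_annulus f a a' b' b c c' d' d :
  a <= a' -> a' <= b' -> b' <= b -> c <= c' -> c' <= d' -> d' <= d ->
  (forall z, in_rect a b c d z ->
    ~ (a' < complex.Re z < b' /\ c' < complex.Im z < d') -> differentiable f z) ->
  rect_integral f a b c d = rect_integral f a' b' c' d'.
Proof.
move=> aa ab' bb cc cd' dd df.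
have cf z : in_rect a b c d z ->
    ~ (a' < complex.Re z < b' /\ c' < complex.Im z < d') -> {for z, continuous f}.
  by move=> hz nz; apply: differentiable_continuous; exact: df.
have f1 : frame_cont f a b c d.
  by move=> z [hz hE]; apply: cf => // -[h1 h2]; case: hE; lra.
have f2 : frame_cont f a' b c d.
  move=> z [/andP[h3 h4] hE]; apply: cf; first by rewrite /in_rect; lra.
  by move=> -[h1 h2]; case: hE; lra.
have f3 : frame_cont f a' b' c d.
  move=> z [/andP[h3 h4] hE]; apply: cf; first by rewrite /in_rect; lra.
  by move=> -[h1 h2]; case: hE; lra.
have f4 : frame_cont f a' b' c' d.
  move=> z [/andP[h3 h4] hE]; apply: cf; first by rewrite /in_rect; lra.
  by move=> -[h1 h2]; case: hE; lra.
have -> := rect_integral_splitx aa (_ : a' <= b) (_ : c <= d) f1; try lra.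
have -> := rect_integral_splitx ab' bb (_ : c <= d) f2; try lra.
have -> := rect_integral_splity ab' cc (_ : c' <= d) f3; try lra.
have -> := rect_integral_splity ab' cd' dd f4.
rewrite [rect_integral f a a' c d]goursat; try lra; last first.
  move=> z /andP[h1 h2]; apply: df; first by rewrite /in_rect; lra.
  by move=> -[h3 h4]; lra.
rewrite [rect_integral f b' b c d]goursat; try lra; last first.
  move=> z /andP[h1 h2]; apply: df; first by rewrite /in_rect; lra.
  by move=> -[h3 h4]; lra.
rewrite [rect_integral f a' b' c c']goursat; try lra; last first.
  move=> z /andP[h1 h2]; apply: df; first by rewrite /in_rect; lra.
  by move=> -[h3 h4]; lra.
rewrite [rect_integral f a' b' d' d]goursat; try lra; last first.
  move=> z /andP[h1 h2]; apply: df; first by rewrite /in_rect; lra.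
  by move=> -[h3 h4]; lra.
Qed.

Lemma continuous_div_sub f (p z : C) : differentiable f z -> z != p ->
  differentiable (fun w => f w / (w - p)) z.
Proof.
move=> df zp; apply: (differentiableM df); apply: differentiableV.
  exact: (entireB (@entire_id R) (entire_cst p)).
by rewrite subr_eq0.
Qed.

Lemma Re_real_div (m x y : R) :
  complex.Re (m%:C / ((x +i* y) : C)) = m * x / (x ^+ 2 + y ^+ 2).
Proof. by rewrite /=; ring. Qed.

Lemma Im_real_div (m x y : R) :
  complex.Im (m%:C / ((x +i* y) : C)) = - (m * y / (x ^+ 2 + y ^+ 2)).
Proof. by rewrite /=; ring. Qed.

Lemma rect_integral_pole (m s : R) (p : C) : 0 <= m -> 0 < s ->
  4 * m <= rect_integral (fun z : C => m%:C / (z - p)) (complex.Re p - s) (complex.Re p + s)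
    (complex.Im p - s) (complex.Im p + s).
Proof.
move=> m0 s0; case: p => p1 p2 /=.
set a := p1 - s; set b := p1 + s; set c := p2 - s; set d := p2 + s.
have ab : a <= b by rewrite /a /b; lra.
have cd : c <= d by rewrite /c /d; lra.
have cf : frame_cont (fun z : C => m%:C / (z - (p1 +i* p2))) a b c d.
  move=> z [_ hE]; apply: differentiable_continuous.
  apply: (@continuous_div_sub (fun=> m%:C)); first exact: entire_cst.
  by apply/eqP => zE; case: hE; rewrite zE /= /a /b /c /d; lra.
have key (t : R) : `|t| <= s -> m / (2 * s) <= m * s / (s ^+ 2 + t ^+ 2).
  rewrite ler_norml => /andP[t1 t2].
  have ss : 0 < s ^+ 2 by rewrite exprn_gt0.
  have tt : 0 <= t ^+ 2 by rewrite sqr_ge0.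
  have ts : t ^+ 2 <= s ^+ 2 by nra.
  rewrite ler_pdivrMr; last by lra.
  rewrite mulrAC ler_pdivlMr; last by lra.
  have -> : m * s * (2 * s) = m * (2 * s ^+ 2) by ring.
  by rewrite ler_wpM2l //; lra.
have len1 : m / (2 * s) * (b - a) = m by rewrite /a /b; field; lra.
have len2 : m / (2 * s) * (d - c) = m by rewrite /c /d; field; lra.
have lo (g : R -> R) x y : x <= y -> seg_cont g x y -> (forall t, x <= t <= y -> m / (2 * s) <= g t) ->
    m / (2 * s) * (y - x) <= seg_integral g x y.
  move=> xy cg Hg; rewrite -seg_integral_cst //; apply: le_seg_integral => //; exact: seg_cont_cst.
have hi (g : R -> R) x y : x <= y -> seg_cont g x y -> (forall t, x <= t <= y -> g t <= - (m / (2 * s))) ->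
    seg_integral g x y <= - (m / (2 * s) * (y - x)).
  move=> xy cg Hg; rewrite -mulNr -seg_integral_cst //; apply: le_seg_integral => //; exact: seg_cont_cst.
have h1 := lo _ _ _ ab (frame_cont_h cd cf (or_introl erefl)).
have h2 := hi _ _ _ ab (frame_cont_h cd cf (or_intror erefl)).
have h3 := lo _ _ _ cd (frame_cont_v ab cf (or_intror erefl)).
have h4 := hi _ _ _ cd (frame_cont_v ab cf (or_introl erefl)).
rewrite len1 in h1 h2; rewrite len2 in h3 h4.
have sub (x y : R) : (x +i* y : C) - (p1 +i* p2) = (x - p1) +i* (y - p2) by [].
have {}h1 : m <= horiz_integral (fun z : C => m%:C / (z - (p1 +i* p2))) a b c.
  apply: h1 => t; rewrite /a /b /c => tab; rewrite sub Im_real_div.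
  apply: le_trans (key (t - p1) _) _; first by rewrite ler_norml; lra.
  by rewrite (_ : p2 - s - p2 = - s) ?mulrN ?mulNr ?opprK ?sqrrN 1?addrC //; ring.
have {}h2 : horiz_integral (fun z : C => m%:C / (z - (p1 +i* p2))) a b d <= - m.
  apply: h2 => t; rewrite /a /b /d => tab; rewrite sub Im_real_div lerN2.
  apply: le_trans (key (t - p1) _) _; first by rewrite ler_norml; lra.
  by rewrite (_ : p2 + s - p2 = s) 1?addrC //; ring.
have {}h3 : m <= vert_integral (fun z : C => m%:C / (z - (p1 +i* p2))) c d b.
  apply: h3 => t; rewrite /c /d /b => tab; rewrite sub Re_real_div.
  apply: le_trans (key (t - p2) _) _; first by rewrite ler_norml; lra.
  by rewrite (_ : p1 + s - p1 = s) //; ring.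
have {}h4 : vert_integral (fun z : C => m%:C / (z - (p1 +i* p2))) c d a <= - m.
  apply: h4 => t; rewrite /c /d /a => tab; rewrite sub Re_real_div.
  rewrite (_ : p1 - s - p1 = - s); last by ring.
  rewrite mulrN mulNr sqrrN lerN2.
  by apply: (key (t - p2) _); rewrite ler_norml; lra.
rewrite /rect_integral; lra.
Qed.

(** Perimeter 8r of the square of half side r, times the bound 1 / (r - |p|) for 1 / |z - p|,
    divided by the 4 of [rect_integral_pole]. *)
Definition cauchy_const (r : R) (p : C) : R := 2 * r / (r - normc p).

(** The boundary of the square of half side r lies in the annulus r <= |z| <= 2r. There f(z) / (z -
    p) is estimated directly; near p it is compared with the pole f(p) / (z - p). *)
Lemma cauchy_bound f (r M : R) (p : C) : entire f -> normc p < r ->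
  (forall z, r <= normc z <= 2 * r -> normc (f z) <= M) ->
  normc (f p) <= cauchy_const r p * M.
Proof.
move=> ef pr fM.
have r0 : 0 < r := le_lt_trans (normc_ge0 p) pr.
have de0 : 0 < r - normc p by lra.
(* A unimodular factor making the value at p real and nonnegative, so that the imaginary part of the
   contour integral sees all of it. *)
pose u : C := if f p == 0 then 1 else (normc (f p))%:C / f p.
have nu : normc u = 1.
  rewrite /u; case: eqVneq => [_|fp]; first by rewrite normc1.
  rewrite normcM normcV normc_realE ger0_norm ?normc_ge0 // divff //.
  by rewrite gt_eqF // normc_gt0.
have ufp : u * f p = (normc (f p))%:C.
  rewrite /u; case: eqVneq => [->|fp]; first by rewrite mulr0 normc0.
  by rewrite divfK.
pose F z := u * f z.
have eF : entire F by apply: entireM => //; exact: entire_cst.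
have nF z : normc (F z) = normc (f z) by rewrite normcM nu mul1r.
have [q Fq] := differentiable_cderiv (eF p).
have [d d0 Hd] := Fq 1 ltr01.
pose G z := F z / (z - p).
have dG z : z != p -> differentiable G z.
  by move=> zp; apply: continuous_div_sub.
have pRe := Re_le_normc p; have pIm := Im_le_normc p.
move: pRe pIm; rewrite !ler_norml => /andP[pRe1 pRe2] /andP[pIm1 pIm2].
pose L := normc q + 1.
have L0 : 0 <= L by rewrite addr_ge0 // normc_ge0.
have outer : `|rect_integral G (- r) r (- r) r| <= M / (r - normc p) * (8 * r).
  have -> : 8 * r = 2 * (r - - r) + 2 * (r - - r) by ring.
  apply: rect_integral_le; [by lra|by lra| |].
    move=> z [_ hE]; apply: differentiable_continuous; apply: dG.
    by apply/eqP => zE; case: hE; rewrite zE; lra.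
  move=> z [/andP[h1 h2] hE]; have nz : r <= normc z <= 2 * r.
    apply/andP; split; last first.
      apply: le_trans (normc_le_ReIm _) _.
      have -> : 2 * r = r + r by ring.
      by apply: lerD; rewrite ler_norml; lra.
    have := Re_le_normc z; have := Im_le_normc z.
    by rewrite !ler_norml; case: hE => ->; lra.
  rewrite /G normcM normcV nF; apply: ler_pM; rewrite ?invr_ge0 ?normc_ge0 //.
    exact: fM.
  have zp := normc_subr_ge z p.
  rewrite lef_pV2 ?posrE //; try lra.
(* Here s is the half side of a small square around p; [2 * s < d] keeps it in the disc where the
   derivative at p controls F, and the error term vanishes as s tends to 0. *)
suff main s : 0 < s -> s < r - normc p -> 2 * s < d ->
    4 * normc (f p) <= M / (r - normc p) * (8 * r) + L * (8 * s).
  suff : 4 * normc (f p) <= M / (r - normc p) * (8 * r).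
    rewrite /cauchy_const => h; rewrite -(ler_pM2l (_ : 0 < 4)) //.
    by apply: le_trans h _; rewrite le_eqVlt; apply/orP; left; apply/eqP; ring.
  apply/ler_addgt0Pl => e e0; rewrite addrC.
  pose s := Num.min (Num.min ((r - normc p) / 2) (d / 4)) (e / (8 * (L + 1))).
  have L8 : 0 < 8 * (L + 1) by lra.
  have s0 : 0 < s by rewrite !lt_min !divr_gt0.
  have s1 : s <= (r - normc p) / 2 by rewrite /s !ge_min lexx.
  have s2 : s <= d / 4 by rewrite /s !ge_min lexx orbT.
  have s3 : s <= e / (8 * (L + 1)) by rewrite /s !ge_min lexx orbT.
  apply: le_trans (main s s0 _ _) _; try lra.
  rewrite lerD2l; move: s3; rewrite ler_pdivlMr // => s3.
  by apply: le_trans s3; nra.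
move=> s0 sr sd.
have := @rect_integral_pole (normc (f p)) s p (normc_ge0 _) s0.
set a := complex.Re p - s; set b := complex.Re p + s.
set c := complex.Im p - s; set e := complex.Im p + s.
have ab : a <= b by rewrite /a /b; lra.
have ce : c <= e by rewrite /c /e; lra.
have GE : rect_integral G (- r) r (- r) r = rect_integral G a b c e.
  have h1 : - r <= a by rewrite /a; lra.
  have h2 : b <= r by rewrite /b; lra.
  have h3 : - r <= c by rewrite /c; lra.
  have h4 : e <= r by rewrite /e; lra.
  apply: (rect_integral_annulus h1 ab h2 h3 ce h4); rewrite /a /b /c /e.
  by move=> z _ hz; apply: dG; apply/eqP => zE; apply: hz; rewrite zE; lra.
have neqp z : in_frame a b c e z -> z != p.
  move=> [_ hE]; apply/eqP => zE; move: hE; rewrite zE /a /b /c /e.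
  by clear -s0; case; lra.
have cG : frame_cont G a b c e.
  by move=> z /neqp zp; apply: differentiable_continuous; exact: dG.
have cP : frame_cont (fun z : C => (normc (f p))%:C / (z - p)) a b c e.
  move=> z /neqp zp; apply: differentiable_continuous.
  by apply: (@continuous_div_sub (fun=> _)) => //; exact: entire_cst.
have := rect_integralB ab ce cG cP; rewrite -GE => dE.
have : `|rect_integral (fun z : C => G z - (normc (f p))%:C / (z - p)) a b c e| <= L * (8 * s).
  have -> : 8 * s = 2 * (b - a) + 2 * (e - c) by rewrite /a /b /c /e; ring.
  apply: (rect_integral_le ab ce).
    by move=> z hz; apply: continuousB; [exact: cG|exact: cP].
  move=> z hz; have zp := neqp _ hz; case: hz => /andP[h1 h2] _.
  have nzp : normc (z - p) < d.
    apply: le_lt_trans sd; apply: le_trans (normc_le_ReIm _) _.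
    have -> : 2 * s = s + s by ring.
    apply: lerD; rewrite ?ReB ?ImB ler_norml; [move: h1|move: h2];
      by rewrite /a /b /c /e; clear; lra.
  have zp0 : 0 < normc (z - p) by rewrite normc_gt0 subr_eq0.
  rewrite /G -mulrBl -ufp normcM normcV ler_pdivrMr //.
  have := Hd _ nzp; rewrite mul1r => Hz.
  (* Thus |F z - F p| <= L |z - p|: without its pole the integrand stays bounded by L near p. *)
  have -> : F z - u * f p = (F z - F p - q * (z - p)) + q * (z - p).
    by rewrite subrK.
  apply: le_trans (le_normcD _ _) _; rewrite normcM /L mulrDl mul1r addrC lerD2l.
  exact: Hz.
rewrite dE => h1 h2.
have := ler_norm (rect_integral G (- r) r (- r) r).
move: h1; rewrite ler_norml => /andP[h1 _] h3; clear -h1 h2 h3 outer; lra.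
Qed.

End CauchyBound.

(** * Removing constants by taking powers *)

Section Powers.
Variable R : realType.

(** If y < x with y positive, then (x/y)^n exceeds b/a for large n, by Bernoulli's inequality. *)
Lemma le_of_powers (a b x y : R) : 0 < a -> 0 <= x -> 0 <= y ->
  (forall n, a * x ^+ n.+1 <= b * y ^+ n.+1) -> x <= y.
Proof.
move=> a0 x0 y0 H; rewrite leNgt; apply/negP => yx.
have xp : 0 < x := le_lt_trans y0 yx.
have [y00|yn0] := eqVneq y 0.
  by have := H 0%N; rewrite y00 !expr1 mulr0 leNgt mulr_gt0.
have yp : 0 < y by rewrite lt_def yn0.
have t0 : 0 < x / y - 1 by rewrite subr_gt0 ltr_pdivlMr // mul1r.
have bern n : 1 + n%:R * (x / y - 1) <= (x / y) ^+ n.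
  elim: n => [|n IH]; first by rewrite mul0r addr0 expr0.
  rewrite exprS; apply: le_trans (ler_wpM2l _ IH); last by rewrite ltW ?divr_gt0.
  have nn : (0 : R) <= n%:R by rewrite ler0n.
  have := mulr_ge0 nn (sqr_ge0 (x / y - 1)); rewrite -natr1.
  by move: (x / y) (n%:R : R) => u v; nra.
have key n : a * (n%:R * (x / y - 1)) <= b.
  apply: le_trans (_ : a * (x / y) ^+ n.+1 <= _).
    rewrite ler_pM2l //; apply: le_trans (bern n.+1).
    by rewrite -natr1; lra.
  by rewrite expr_div_n mulrA ler_pdivrMr ?exprn_gt0.
have := key (Num.truncn (b / (a * (x / y - 1)))).+1; apply/negP.
rewrite -ltNge mulrCA -ltr_pdivrMr; last by rewrite mulr_gt0.
exact: truncnS_gt.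
Qed.

End Powers.

(** * Maximum principle, identity theorem and division by zeros *)

Section Entire.
Variable R : realType.
Local Notation C := (Num.NumField.sort (complex R : numFieldType)).
Implicit Types (f g q : C -> C) (p z : C).

Lemma continuous_toC : continuous (fun v : R * R => (v.1 +i* v.2 : C)).
Proof.
move=> [x y]; apply/(@cvgrPdist_lt C C (R * R)%type (nbhs (x, y)) (nbhs_filter _)).
move=> _ /gtc0_real[e e0 ->].
have e2 : 0 < e / 2 by rewrite divr_gt0.
exists (ball x (e / 2), ball y (e / 2)) => /=.
  by split; apply: nbhsx_ballx.
move=> [x' y'] [hx hy]; rewrite normC_normc ltcR.
apply: le_lt_trans (normc_le_ReIm _) _; rewrite ReB ImB.
by rewrite [ltRHS]splitr; apply: ltrD; [exact: hx|exact: hy].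
Qed.

Lemma continuous_normcR : continuous (fun z : C => normc z : R).
Proof.
move=> z; apply/(@cvgrPdist_lt R R C (nbhs z) (nbhs_filter _)) => e e0.
apply/nbhs_normc; exists e => // w wz; apply: le_lt_trans wz.
have h1 := normc_subr_ge w z; have h2 := normc_subr_ge z w.
rewrite normc_distC in h2; rewrite ler_norml; lra.
Qed.

Lemma bounded_bidisc (G : C * C -> C) (r : R) : continuous G ->
  exists M, forall z w, normc z <= r -> normc w <= r -> normc (G (z, w)) <= M.
Proof.
move=> cG.
pose toC (v : R * R) : C := v.1 +i* v.2.
pose h (v : (R * R) * (R * R)) : R := normc (G (toC v.1, toC v.2)).
have ch : continuous h.
  move=> v; apply: (@continuous_comp _ _ _ (fun v : (R * R) * (R * R) => G (toC v.1, toC v.2)));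
    last exact: continuous_normcR.
  apply: (@continuous_comp _ _ _ (fun v : (R * R) * (R * R) => (toC v.1, toC v.2)));
    last exact: cG.
  apply: (@cvg_pair _ C C (nbhs v) (nbhs (toC v.1)) (nbhs (toC v.2))).
    by apply: (@continuous_comp _ _ _ fst toC); [exact: cvg_fst|exact: continuous_toC].
  by apply: (@continuous_comp _ _ _ snd toC); [exact: cvg_snd|exact: continuous_toC].
pose I : set R := [set` `[- r, r]%R].
have cI : compact I by exact: segment_compact.
have cK : compact ((I `*` I) `*` (I `*` I)) by do !apply: compact_setX.
have /compact_bounded[M [_ HM]] :=
  continuous_compact (continuous_subspaceT ch) cK.
exists (M + 1) => z w zr wr.
have inI (u : C) : normc u <= r -> (I `*` I) (complex.Re u, complex.Im u).
  move=> ur; split => /=; rewrite /I /= in_itv /= -ler_norml.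
    exact: le_trans (Re_le_normc _) ur.
  exact: le_trans (Im_le_normc _) ur.
have M1 : M < M + 1 by rewrite ltrDl.
pose v := ((complex.Re z, complex.Im z), (complex.Re w, complex.Im w)).
have hv : h v = normc (G (z, w)) by rewrite /h /toC /=; case: z {zr v}; case: w {wr}.
have /(HM _ M1) : (h @` ((I `*` I) `*` (I `*` I))) (h v).
  by exists v => //; split; exact: inI.
by rewrite /= hv ger0_norm ?normc_ge0.
Qed.

Lemma entire_bounded f (r : R) : entire f ->
  exists M, forall z, normc z <= r -> normc (f z) <= M.
Proof.
move=> ef; have [|M HM] := @bounded_bidisc (fun v => f v.1) r.
  by move=> v; apply: (@continuous_comp _ _ _ fst f); [exact: cvg_fst|exact: entire_continuous].
by exists M => z hz; exact: (HM z z hz hz).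
Qed.

(** A maximum principle for a quotient q with isolated singularities: f compensates them in every
    power of q. Apply [cauchy_bound] to f q^(n+1) and let n grow; f and the constant are lost in the
    roots, provided f(p) is nonzero. *)
Lemma max_mod_except f q (r B M : R) p :
  (forall n, entire (fun z => f z * q z ^+ n.+1)) -> normc p < r ->
  (forall z, r <= normc z <= 2 * r -> normc (f z) <= B) ->
  (forall z, r <= normc z <= 2 * r -> normc (q z) <= M) ->
  f p != 0 -> normc (q p) <= M.
Proof.
move=> ent pr fB qM fp.
have r0 : 0 < r := le_lt_trans (normc_ge0 p) pr.
have M0 : 0 <= M.
  apply: le_trans (normc_ge0 (q r%:C)) (qM _ _).
  by rewrite normc_realE gtr0_norm //; lra.
apply: (@le_of_powers _ (normc (f p)) (cauchy_const r p * B)) => //.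
- by rewrite normc_gt0.
- exact: normc_ge0.
move=> n; rewrite -normcX -normcM -mulrA.
apply: (cauchy_bound (ent n) pr) => z zr; rewrite normcM normcX.
apply: ler_pM; rewrite ?exprn_ge0 ?normc_ge0 ?fB //.
by rewrite lerXn2r ?nnegrE ?normc_ge0 // qM.
Qed.

(** Dividing by z^(n+1) leaves f entire, because f vanishes near 0. [cauchy_bound] then gives |f(p)|
    r^(n+1) <= K |p|^(n+1) with K independent of n; if f(p) were nonzero this would force r <=
    |p|. *)
Lemma entire_zero f (d : R) : entire f -> 0 < d ->
  (forall z, normc z < d -> f z = 0) -> forall z, f z = 0.
Proof.
move=> ef d0 fz0 p; apply/eqP; apply/negP => /negP fp.
pose r := normc p + 1.
have pr : normc p < r by rewrite /r ltrDl.
have r0 : 0 < r := le_lt_trans (normc_ge0 p) pr.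
have [M HM] := entire_bounded (2 * r) ef.
have p0 : p != 0.
  by apply: contraNneq fp => ->; rewrite fz0 ?normc0.
suff : r <= normc p by rewrite leNgt pr.
apply: (@le_of_powers _ (normc (f p)) (cauchy_const r p * M)).
- by rewrite normc_gt0.
- exact: ltW.
- exact: normc_ge0.
move=> n; pose g z := f z * (z ^+ n.+1)^-1.
have eg : entire g.
  move=> z; have [->|z0] := eqVneq z 0.
    apply: (@cderiv_differentiable _ _ _ 0) => e e0; exists d => // w.
    rewrite subr0 => wd; rewrite /g !fz0 ?normc0 //.
    by rewrite !mul0r !subr0 normc0 mulr_ge0 ?normc_ge0 // ltW.
  apply: (differentiableM (ef z)); apply: differentiableV.
    by apply: entireX; exact: entire_id.
  by rewrite expf_neq0.
have := @cauchy_bound _ g r (M / r ^+ n.+1) p eg pr.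
rewrite /g normcM normcV normcX ler_pdivrMr ?exprn_gt0 ?normc_gt0 //.
rewrite mulrA mulrAC ler_pdivlMr ?exprn_gt0 // => H; apply: H.
move=> z /andP[rz zr]; rewrite normcM normcV normcX.
apply: ler_pM; rewrite ?invr_ge0 ?exprn_ge0 ?normc_ge0 ?HM //.
rewrite lef_pV2 ?posrE ?exprn_gt0 //; last exact: lt_le_trans rz.
by rewrite lerXn2r ?nnegrE ?normc_ge0 // ltW.
Qed.

Lemma differentiable_mul_sub (h : C -> C) (k : C) : {for k, continuous h} ->
  differentiable (fun z => (z - k) * h z) k.
Proof.
move=> /continuous_normc ch; apply: (@cderiv_differentiable _ _ _ (h k)).
move=> e e0; have [d d0 Hd] := ch e e0; exists d => // z zk.
rewrite subrr mul0r subr0 [h k * _]mulrC -mulrBr normcM mulrC.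
by rewrite ler_wpM2r ?normc_ge0 // ltW // Hd.
Qed.

Lemma continuous_pow (h : C -> C) (z : C) n : {for z, continuous h} ->
  {for z, continuous (fun u => h u ^+ n)}.
Proof.
move=> ch; elim: n => [|n IH].
  have -> : (fun u => h u ^+ 0) = cst 1 by apply/funext => u; rewrite expr0.
  exact: cst_continuous.
have -> : (fun u => h u ^+ n.+1) = h \* (fun u => h u ^+ n).
  by apply/funext => u; rewrite exprS.
exact: (continuousM ch IH).
Qed.

(* At a zero z = k of the product the quotient takes the junk value f k / 0 = 0. *)
Definition rootquot f (s : seq C) (z : C) : C := f z / \prod_(k <- s) (z - k).

Lemma entire_prod_sub (s : seq C) : entire (fun z => \prod_(k <- s) (z - k)).
Proof.
elim: s => [|k s IH]; first by under eq_fun do rewrite big_nil; exact: entire_cst.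
under eq_fun do rewrite big_cons.
exact: (entireM (entireB (@entire_id R) (entire_cst k)) IH).
Qed.

Lemma prod_sub_neq0 (s : seq C) (z : C) :
  (\prod_(k <- s) (z - k) != 0) = (z \notin s).
Proof.
elim: s => [|k s IH]; first by rewrite big_nil oner_neq0.
by rewrite big_cons mulf_eq0 negb_or IH inE negb_or subr_eq0.
Qed.

(** Avoids the removable singularity theorem. At a root z the product supplies one factor u - z, and
    (u - z) times a merely continuous function is differentiable at z. *)
Lemma entire_rootquot f (s : seq C) n : entire f -> uniq s ->
  (forall k, k \in s -> f k = 0) ->
  entire (fun z => \prod_(k <- s) (z - k) * rootquot f s z ^+ n.+1).
Proof.
move=> ef us fs z; have [zs|zs] := boolP (z \in s); last first.
  apply: differentiableM; first exact: entire_prod_sub.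
  apply: differentiable_powX; apply: (differentiableM (ef z)); apply: differentiableV.
    exact: entire_prod_sub.
  by rewrite prod_sub_neq0.
have [b fb] := differentiable_cderiv (ef z).
(* The continuous extension of the difference quotient. Replacing the junk value of [rootquot] by it
   changes nothing at u = z, where both sides carry the factor u - z = 0. *)
pose psi u := if u == z then b else f u / (u - z).
have sE u : \prod_(k <- s) (u - k) = (u - z) * \prod_(k <- rem z s) (u - k).
  by rewrite (perm_big _ (perm_to_rem zs)) big_cons.
have -> : (fun u => \prod_(k <- s) (u - k) * rootquot f s u ^+ n.+1) =
  fun u => (u - z) * (\prod_(k <- rem z s) (u - k) *
    (psi u / \prod_(k <- rem z s) (u - k)) ^+ n.+1).
  apply/funext => u; rewrite /rootquot !sE mulrA /psi.
  by case: eqVneq => [->|uz]; rewrite ?subrr ?mul0r // invfM mulrA.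
have w1z : \prod_(k <- rem z s) (z - k) != 0.
  by rewrite prod_sub_neq0 mem_rem_uniqF.
apply: differentiable_mul_sub.
have c1 : {for z, continuous (fun u : C => \prod_(k <- rem z s) (u - k))}.
  by apply: entire_continuous; exact: entire_prod_sub.
have cpsi : {for z, continuous psi}.
  apply: normc_continuous => e e0; have e2 : 0 < e / 2 by rewrite divr_gt0.
  have [d d0 Hd] := fb _ e2.
  exists d => // u ud; rewrite /psi eqxx; case: eqVneq => [_|uz].
    by rewrite subrr normc0.
  have uz0 : 0 < normc (u - z) by rewrite normc_gt0 subr_eq0.
  have := Hd u ud; rewrite (fs z zs) subr0 => Hu.
  have -> : f u / (u - z) - b = (f u - b * (u - z)) / (u - z).
    by rewrite mulrBl mulfK // subr_eq0.
  rewrite normcM normcV ltr_pdivrMr //; apply: le_lt_trans Hu _.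
  by rewrite ltr_pM2r //; lra.
have cq : {for z, continuous (fun u => psi u / \prod_(k <- rem z s) (u - k))}.
  exact: (cvgM cpsi (cvgV w1z c1)).
exact: (continuousM c1 (continuous_pow cq)).
Qed.

(** A Schwarz lemma for several zeros: [max_mod_except] applied to the quotient of f by the product,
    which itself serves as the compensating factor. *)
Lemma rootquot_bound f (s : seq C) (r M e : R) z : entire f -> uniq s ->
  (forall k, k \in s -> f k = 0) -> normc z < r -> 0 < e ->
  (forall u, r <= normc u <= 2 * r -> normc (f u) <= M) ->
  (forall u, r <= normc u <= 2 * r -> e <= normc (\prod_(k <- s) (u - k))) ->
  normc (f z) <= M / e * normc (\prod_(k <- s) (z - k)).
Proof.
move=> ef us fs zr e0 fM we.
have [zs|zs] := boolP (z \in s).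
  have r0 : 0 < r := le_lt_trans (normc_ge0 z) zr.
  have M0 : 0 <= M.
    apply: le_trans (normc_ge0 (f r%:C)) (fM _ _).
    by rewrite normc_realE gtr0_norm //; lra.
  by rewrite fs // normc0 mulr_ge0 ?normc_ge0 // divr_ge0 // ltW.
have wz : \prod_(k <- s) (z - k) != 0 by rewrite prod_sub_neq0.
have [B HB] := entire_bounded (2 * r) (@entire_prod_sub s).
rewrite -ler_pdivrMr ?normc_gt0 // -normcV -normcM -/(rootquot f s z).
apply: (@max_mod_except (fun u => \prod_(k <- s) (u - k)) (rootquot f s) r B) => //.
- by move=> n; exact: entire_rootquot.
- by move=> u /andP[_ ur]; exact: HB.
move=> u ur; rewrite /rootquot normcM normcV.
apply: ler_pM; rewrite ?invr_ge0 ?normc_ge0 ?fM //.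
by rewrite lef_pV2 ?posrE ?we // (lt_le_trans e0) ?we.
Qed.

End Entire.

(** * Bounds on divided differences, and differentiability of limits *)

Section DividedDifferences.
Variable R : realType.
Local Notation C := (Num.NumField.sort (complex R : numFieldType)).
Implicit Types (f g : C -> C) (h k l z : C).

Lemma annulus_sub_ge (r : R) z k : r <= normc z -> normc k <= r / 2 ->
  r / 2 <= normc (z - k).
Proof. by move=> zr kr; apply: le_trans (normc_subr_ge z k); lra. Qed.

(** [rootquot_bound] for f - f(k) with its single zero k: the numerator is at most 2M and |u - k| at
    least r/2 on the annulus. *)
Lemma entire_lipschitz f (r M : R) h k : 0 < r -> entire f ->
  (forall z, normc z <= 2 * r -> normc (f z) <= M) ->
  normc h <= r / 2 -> normc k <= r / 2 ->
  normc (f h - f k) <= 4 * M / r * normc (h - k).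
Proof.
move=> r0 ef fM hr kr.
have eg : entire (fun z => f z - f k) := entireB ef (entire_cst (f k)).
have := @rootquot_bound _ (fun z => f z - f k) [:: k] r (2 * M) (r / 2) h eg.
rewrite big_seq1 (_ : 2 * M / (r / 2) = 4 * M / r); last by field; lra.
apply => //; try lra.
- by move=> u; rewrite inE => /eqP ->; rewrite subrr.
- move=> u /andP[_ ur]; apply: le_trans (normcB _ _) _.
  have kM := fM k (_ : normc k <= 2 * r).
  have := fM u ur; have -> : 2 * M = M + M by ring.
  by move=> uM; apply: lerD => //; apply: kM; lra.
- by move=> u /andP[ur _]; rewrite big_seq1; exact: annulus_sub_ge.
Qed.

(** Subtracting the secant through k and l leaves a function [g] with the two zeros k and l, to
    which [rootquot_bound] applies. The statement is multiplied out so that it survives coinciding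
    points and limits. *)
Lemma entire_second_difference f (r M : R) h k l : 0 < r -> entire f ->
  (forall z, normc z <= 2 * r -> normc (f z) <= M) ->
  normc h <= r / 2 -> normc k <= r / 2 -> normc l <= r / 2 ->
  normc ((f h - f k) * (l - k) - (f l - f k) * (h - k)) <=
    48 * M / r ^+ 2 * (normc (h - k) * normc (h - l) * normc (l - k)).
Proof.
move=> r0 ef fM hr kr lr.
have M0 : 0 <= M.
  by apply: le_trans (normc_ge0 (f 0)) (fM _ _); rewrite normc0; lra.
have rhs0 : 0 <= 48 * M / r ^+ 2 * (normc (h - k) * normc (h - l) * normc (l - k)).
  by rewrite !mulr_ge0 ?normc_ge0 ?invr_ge0 ?exprn_ge0 // ltW.
have [lk|lk] := eqVneq l k.
  rewrite {1 2}lk !subrr mulr0 mul0r subrr normc0.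
  by rewrite mulr_ge0 // ?mulr_ge0 ?normc_ge0 ?invr_ge0 ?exprn_ge0 // ltW.
have lk0 : 0 < normc (l - k) by rewrite normc_gt0 subr_eq0.
pose c := (f l - f k) / (l - k).
have nc : normc c <= 4 * M / r.
  rewrite /c normcM normcV ler_pdivrMr //.
  exact: (entire_lipschitz r0 ef fM).
pose g z := f z - f k - c * (z - k).
have eg : entire g.
  apply: (entireB (entireB ef (entire_cst (f k)))).
  exact: (entireM (entire_cst c) (entireB (@entire_id R) (entire_cst k))).
(* 2M from f(u) - f(k), and 10M from the slope 4M/r times |u - k| <= 5r/2. *)
have gM u : r <= normc u <= 2 * r -> normc (g u) <= 12 * M.
  move=> /andP[_ ur]; rewrite /g.
  apply: le_trans (normcB _ _) _.
  have h1 : normc (f u - f k) <= 2 * M.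
    apply: le_trans (normcB _ _) _; have -> : 2 * M = M + M by ring.
    by apply: lerD; apply: fM; lra.
  have h2 : normc (c * (u - k)) <= 4 * M / r * (5 / 2 * r).
    rewrite normcM; apply: ler_pM; rewrite ?normc_ge0 //.
    by apply: le_trans (normcB _ _) _; lra.
  have h3 : 4 * M / r * (5 / 2 * r) = 10 * M by field; lra.
  by rewrite h3 in h2; lra.
have us : uniq [:: k; l] by rewrite /= inE eq_sym lk.
have gs z : z \in [:: k; l] -> g z = 0.
  rewrite !inE /g => /orP[] /eqP ->; first by rewrite !subrr mulr0 subr0.
  by rewrite /c divfK ?subrr // subr_eq0.
have wM u : r <= normc u <= 2 * r ->
    (r / 2) * (r / 2) <= normc (\prod_(z <- [:: k; l]) (u - z)).
  move=> /andP[ur _]; rewrite big_cons big_seq1 normcM.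
  by apply: ler_pM; rewrite ?annulus_sub_ge //; lra.
have hrr : normc h < r by lra.
have e0 : 0 < r / 2 * (r / 2) by rewrite mulr_gt0 //; lra.
have := rootquot_bound eg us gs hrr e0 gM wM.
rewrite big_cons big_seq1 normcM.
have -> : 12 * M / (r / 2 * (r / 2)) = 48 * M / r ^+ 2 by field; lra.
move=> gh; have -> : (f h - f k) * (l - k) - (f l - f k) * (h - k) = g h * (l - k).
  by rewrite /g /c; field; rewrite subr_eq0.
by rewrite normcM mulrA; apply: ler_wpM2r gh; rewrite normc_ge0.
Qed.

(* A function whose second divided differences at 0 are bounded has Lipschitz
   difference quotients, whose limit is found as an infimum. *)
Lemma lipschitz_limit (E : C -> R) (r K : R) : 0 < r -> 0 <= K ->
  (forall h l, h != 0 -> l != 0 -> normc h <= r -> normc l <= r ->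
     `|E h - E l| <= K * normc (h - l)) ->
  exists b, forall h, h != 0 -> normc h <= r -> `|E h - b| <= K * normc h.
Proof.
move=> r0 K0 HE.
pose S := [set x | exists2 h : C, h != 0 /\ normc h <= r & x = E h + K * normc h].
have lb h : h != 0 -> normc h <= r -> lbound S (E h - K * normc h).
  move=> h0 hr _ [l [l0 lr] ->]; have := HE h l h0 l0 hr lr.
  have : K * normc (h - l) <= K * normc h + K * normc l.
    by rewrite -mulrDr ler_wpM2l // normcB.
  rewrite ler_norml; lra.
have rC0 : r%:C != 0 :> C by rewrite -normc_gt0 normc_realE normr_gt0 gt_eqF.
have rCr : normc (r%:C : C) <= r by rewrite normc_realE gtr0_norm.
have S0 : S !=set0 by exists (E r%:C + K * normc (r%:C : C)), r%:C.
have hS : has_lbound S by exists (E r%:C - K * normc (r%:C : C)); exact: lb.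
exists (inf S) => h h0 hr.
have h1 : inf S <= E h + K * normc h by apply: ge_inf => //; exists h.
have h2 : E h - K * normc h <= inf S by apply: lb_le_inf => //; exact: lb.
rewrite ler_norml; lra.
Qed.

Lemma differentiable_second_difference f (r K : R) : 0 < r -> 0 <= K ->
  (forall h l, normc h <= r -> normc l <= r ->
     normc ((f h - f 0) * l - (f l - f 0) * h) <=
       K * (normc h * normc (h - l) * normc l)) ->
  differentiable f (0 : C).
Proof.
move=> r0 K0 Hf; pose E h := (f h - f 0) / h.
have HE h l : h != 0 -> l != 0 -> normc h <= r -> normc l <= r ->
    normc (E h - E l) <= K * normc (h - l).
  move=> h0 l0 hr lr; have := Hf h l hr lr.
  have -> : (f h - f 0) * l - (f l - f 0) * h = (E h - E l) * (h * l).
    by rewrite /E; field; rewrite ?h0 ?l0.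
  have hl : 0 < normc h * normc l by rewrite mulr_gt0 ?normc_gt0.
  rewrite !normcM (_ : K * _ = K * normc (h - l) * (normc h * normc l)).
    by rewrite ler_pM2r.
  by ring.
have [h l h0 l0 hr lr|b1 Hb1] := @lipschitz_limit (fun h => complex.Re (E h)) r K r0 K0.
  by rewrite -ReB; apply: le_trans (Re_le_normc _) _; exact: HE.
have [h l h0 l0 hr lr|b2 Hb2] := @lipschitz_limit (fun h => complex.Im (E h)) r K r0 K0.
  by rewrite -ImB; apply: le_trans (Im_le_normc _) _; exact: HE.
apply: (@cderiv_differentiable _ _ _ (b1 +i* b2)) => e e0.
(* The real and imaginary parts each contribute K; the 1 keeps the denominator positive when K =
   0. *)
have K1 : 0 < 2 * K + 1 by lra.
exists (Num.min r (e / (2 * K + 1))) => [|z].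
  by rewrite lt_min r0 divr_gt0.
rewrite subr0 lt_min => /andP[zr ze].
have [->|z0] := eqVneq z 0; first by rewrite subrr mulr0 subrr normc0 mulr0.
have -> : f z - f 0 - (b1 +i* b2) * z = (E z - (b1 +i* b2)) * z.
  by rewrite /E; field.
rewrite normcM ler_wpM2r ?normc_ge0 //.
apply: le_trans (normc_le_ReIm _) _; rewrite ReB ImB /=.
have := Hb1 z z0 (ltW zr); have := Hb2 z z0 (ltW zr).
move: ze; rewrite ltr_pdivlMr // => ze h1 h2.
have := normc_ge0 z; nra.
Qed.

(** A second difference involves three values only, so the approximating entire function may depend
    on the three points and on e; only the bound M is uniform. *)
Lemma differentiable_locally_bounded_limit f (r M : R) : 0 < r ->
  (forall z1 z2 z3, normc z1 <= r / 2 -> normc z2 <= r / 2 -> normc z3 <= r / 2 ->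
     forall e, 0 < e -> exists g, [/\ entire g,
     (forall z, normc z <= 2 * r -> normc (g z) <= M),
     normc (g z1 - f z1) <= e, normc (g z2 - f z2) <= e &
     normc (g z3 - f z3) <= e]) -> differentiable f (0 : C).
Proof.
move=> r0 H; have r2 : 0 < r / 2 by lra.
have n0 : normc (0 : C) <= r / 2 by rewrite normc0 ltW.
have M0 : 0 <= M.
  have [g [_ gM _ _ _]] := H 0 0 0 n0 n0 n0 1 ltr01.
  by apply: le_trans (normc_ge0 (g 0)) (gM _ _); rewrite normc0; lra.
apply: (@differentiable_second_difference f (r / 2) (48 * M / r ^+ 2)) => //.
  by rewrite mulr_ge0 ?mulr_ge0 ?invr_ge0 ?exprn_ge0 // ltW.
move=> h l hr lr; apply/ler_addgt0Pl => e e0.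
(* Two error products, each at most 2 (e / (2r)) (r/2) = e/2. *)
have d0 : 0 < e / (2 * r) by rewrite divr_gt0 //; lra.
have [g [eg gM g1 g2 g3]] := H h l 0 hr lr n0 _ d0.
have := entire_second_difference r0 eg gM hr n0 lr; rewrite !subr0 => D2.
have -> : (f h - f 0) * l - (f l - f 0) * h =
  ((g h - g 0) * l - (g l - g 0) * h) -
  (((g h - f h) - (g 0 - f 0)) * l - ((g l - f l) - (g 0 - f 0)) * h) by ring.
apply: le_trans (normcB _ _) _; rewrite addrC; apply: lerD => //.
apply: le_trans (normcB _ _) _; rewrite !normcM.
have le1 : normc (g h - f h - (g 0 - f 0)) * normc l <= (2 * (e / (2 * r))) * (r / 2).
  apply: ler_pM; rewrite ?normc_ge0 //; apply: le_trans (normcB _ _) _; lra.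
have le2 : normc (g l - f l - (g 0 - f 0)) * normc h <= (2 * (e / (2 * r))) * (r / 2).
  apply: ler_pM; rewrite ?normc_ge0 //; apply: le_trans (normcB _ _) _; lra.
have -> : e = (2 * (e / (2 * r))) * (r / 2) + (2 * (e / (2 * r))) * (r / 2).
  by field; lra.
exact: lerD.
Qed.

End DividedDifferences.

(** * Restriction to complex lines; derivatives of holomorphic functions *)

Section Lines.
Variable R : realType.
Local Notation C := (Num.NumField.sort (complex R : numFieldType)).
Variable V : normedModType C.
Implicit Types (f : V -> C) (x u v : V).

Lemma differentiable_line x v (t : C) : differentiable (fun t : C => x + t *: v) t.
Proof.
apply: differentiableD; first exact: differentiable_cst.
by apply: differentiableZl; exact: entire_id.
Qed.

Lemma entire_line f x v : (forall y, differentiable f y) ->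
  entire (fun t => f (x + t *: v)).
Proof.
by move=> df t; apply: differentiable_comp; [exact: differentiable_line|exact: df].
Qed.

Lemma cderiv_line f x v : differentiable f x ->
  cderiv (fun t => f (x + t *: v)) 0 ('d f x v).
Proof.
move=> df; apply/cderivP; have dv : derivable f x v by exact: diff_derivable.
have E : (fun h : C => h^-1 *: (((fun t => f (x + t *: v)) \o shift 0) (h *: (1 : C)) -
    f (x + 0 *: v))) = (fun h : C => h^-1 *: ((f \o shift x) (h *: v) - f x)).
  apply/funext => h /=; rewrite addr0 scale0r addr0 -[h *: 1]/(h * 1) mulr1.
  by rewrite [h *: v + x]addrC.
apply: DeriveDef; first by rewrite /derivable E.
by rewrite /derive E -deriveE.
Qed.

Lemma cderiv_shift (g : C -> C) (z b : C) :
  cderiv (fun t => g (z + t)) 0 b -> cderiv g z b.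
Proof.
move=> H e /H[d d0 Hd]; exists d => // w wz.
have := Hd (w - z); rewrite subr0 addr0 [z + _]addrC subrK; exact.
Qed.

Lemma continuous_plane f x u v : (forall y, differentiable f y) ->
  continuous (fun w : C * C => f (x + w.1 *: v + w.2 *: u)).
Proof.
move=> df w.
apply: (@continuous_comp _ _ _ (fun w : C * C => x + w.1 *: v + w.2 *: u) f);
  last by apply: differentiable_continuous; exact: df.
apply: cvgD; first apply: cvgD; first exact: cvg_cst.
  by apply: cvgZr_tmp; exact: cvg_fst.
by apply: cvgZr_tmp; exact: cvg_snd.
Qed.

(** The difference quotients in direction u are entire in t and, by [entire_lipschitz] with r = 1,
    bounded by 4M independently of the step; as the step tends to 0 they converge pointwise to the
    differential. *)
Lemma entire_differential f x u v : (forall y, differentiable f y) ->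
  entire (fun t => 'd f (x + t *: v) u).
Proof.
move=> df t0; pose y := x + t0 *: v.
suff : differentiable (fun t : C => 'd f (y + t *: v) u) (0 : C).
  move=> /differentiable_cderiv[b Hb].
  apply: (@cderiv_differentiable _ _ _ b); apply: cderiv_shift.
  by under eq_fun do rewrite scalerDl addrA; exact: Hb.
have [M HM] := bounded_bidisc 2 (@continuous_plane f y u v df).
have c (t : C) := @cderiv_line f (y + t *: v) u (df _).
apply: (@differentiable_locally_bounded_limit _ _ 1 (4 * M)) => // z1 z2 z3 _ _ _ e e0.
have [d1 d10 H1] := c z1 e e0; have [d2 d20 H2] := c z2 e e0.
have [d3 d30 H3] := c z3 e e0.
(* One step s = m/2 has to serve all three points, and has to stay below 1/2 for the Lipschitz
   bound. *)
pose m := Num.min (Num.min d1 d2) (Num.min d3 1).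
have m0 : 0 < m by rewrite !lt_min d10 d20 d30 ltr01.
have [[m1 m2] [m3 m4]] : (m <= d1 /\ m <= d2) /\ (m <= d3 /\ m <= 1).
  by rewrite !ge_min !lexx !orbT.
pose s := m / 2.
have s0 : 0 < s by rewrite divr_gt0.
have s1 : s < d1 by rewrite /s; lra.
have s2 : s < d2 by rewrite /s; lra.
have s3 : s < d3 by rewrite /s; lra.
have s4 : s <= 1 / 2 by rewrite /s; lra.
have ns : normc (s%:C : C) = s by rewrite normc_realE gtr0_norm.
have sn0 : s%:C != 0 :> C by rewrite -normc_gt0 ns.
have close z d : s < d -> (forall w : C, normc (w - 0) < d ->
    normc (f (y + z *: v + w *: u) - f (y + z *: v + 0 *: u) -
      'd f (y + z *: v) u * (w - 0)) <= e * normc (w - 0)) ->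
    normc ((f (y + z *: v + s%:C *: u) - f (y + z *: v)) / s%:C
      - 'd f (y + z *: v) u) <= e.
  move=> sd Hd; have := Hd s%:C; rewrite subr0 scale0r addr0 ns => /(_ sd).
  set A := f _; set B := f _; set D := 'd f _ _ => H.
  have -> : (A - B) / s%:C - D = (A - B - D * s%:C) / s%:C by field.
  by rewrite normcM normcV ns ler_pdivrMr.
exists (fun t => (f (y + t *: v + s%:C *: u) - f (y + t *: v)) / s%:C).
split; [|move=> z zr|exact: close s1 H1|exact: close s2 H2|exact: close s3 H3].
  apply: entireM (entire_cst _); apply: entireB; last exact: entire_line.
  by under eq_fun do rewrite addrAC; exact: entire_line.
have ez : entire (fun s => f (y + z *: v + s *: u)) by exact: entire_line.
have HMz (w : C) : normc w <= 2 * 1 -> normc (f (y + z *: v + w *: u)) <= M.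
  by move=> wr; apply: HM; lra.
have h1 : normc (s%:C : C) <= 1 / 2 by rewrite ns.
have h2 : normc (0 : C) <= 1 / 2 by rewrite normc0; lra.
have := entire_lipschitz ltr01 ez HMz h1 h2.
by rewrite subr0 ns scale0r addr0 divr1 normcM normcV ns ler_pdivrMr.
Qed.

End Lines.

(** * Algebra of entire functions and constancy criteria *)

Section EntireAlgebra.
Variable R : realType.
Local Notation C := (Num.NumField.sort (complex R : numFieldType)).
Implicit Types (f g : C -> C).

Lemma cderiv_unique f (z b c : C) : cderiv f z b -> cderiv f z c -> b = c.
Proof. by move=> /cderivP[_ <-] /cderivP[_ <-]. Qed.

Lemma entire_sum (I : Type) (s : seq I) (P : pred I) (h : I -> C -> C) :
  (forall i, entire (h i)) -> entire (fun z => \sum_(i <- s | P i) h i z).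
Proof.
move=> eh; elim: s => [|i s IH].
  by under eq_fun do rewrite big_nil; exact: entire_cst.
under eq_fun do rewrite big_cons; case: (P i) => //.
exact: (entireD (eh i) IH).
Qed.

Lemma entire_prod (I : Type) (s : seq I) (P : pred I) (h : I -> C -> C) :
  (forall i, entire (h i)) -> entire (fun z => \prod_(i <- s | P i) h i z).
Proof.
move=> eh; elim: s => [|i s IH].
  by under eq_fun do rewrite big_nil; exact: entire_cst.
under eq_fun do rewrite big_cons; case: (P i) => //.
exact: (entireM (eh i) IH).
Qed.

Lemma entire_det n (A : C -> 'M[C]_n) : (forall i j, entire (fun z => A z i j)) ->
  entire (fun z => \det (A z)).
Proof.
move=> eA; rewrite /determinant; apply: entire_sum => s.
by apply: (entireM (entire_cst _)); apply: entire_prod => i; exact: eA.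
Qed.

Lemma entire_mulmx m n k (A : C -> 'M[C]_(m, n)) (B : C -> 'M[C]_(n, k)) :
  (forall i j, entire (fun z => A z i j)) ->
  (forall i j, entire (fun z => B z i j)) ->
  forall i j, entire (fun z => (A z *m B z) i j).
Proof.
move=> eA eB i j; under eq_fun do rewrite mxE.
by apply: entire_sum => l; apply: entireM.
Qed.

Lemma entire_affine (a b : C) : entire (fun z => a + z * b).
Proof. exact: (entireD (entire_cst a) (entireM (@entire_id R) (entire_cst b))). Qed.

(** f has no zero near 0 by continuity, so g vanishes there, and [entire_zero] spreads this. *)
Lemma entire_mul_eq0 f g : entire f -> entire g -> (forall z, f z * g z = 0) ->
  f 0 != 0 -> forall z, g z = 0.
Proof.
move=> ef eg fg f0.
have [d d0 Hd] : exists2 d : R, 0 < d & forall z, normc (z - 0) < d -> f z != 0.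
  have nf : 0 < normc (f 0) by rewrite normc_gt0.
  have [d d0 Hd] := continuous_normc (@entire_continuous _ _ ef 0) nf.
  exists d => // z /Hd; apply: contraTneq => ->.
  by rewrite sub0r normcN ltxx.
apply: (entire_zero eg d0) => z; rewrite -[z]subr0 => /Hd; rewrite subr0 => fz.
by have /eqP := fg z; rewrite mulf_eq0 (negbTE fz) => /eqP.
Qed.

Lemma cderiv0_constant f : (forall z, cderiv f z 0) -> forall z, f z = f 0.
Proof.
move=> df z.
(* Used with the real and imaginary parts of f: along the real segment from 0 to z they have zero
   derivative, so the theorem on real functions applies. *)
have key (g : C -> R) : (forall u v, `|g u - g v| <= normc (f u - f v)) -> g z = g 0.
  move=> Hg; pose h (t : R) := g (t%:C * z).
  suff dh (t : R) : is_derive t (1 : R) h 0.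
    have := is_derive_0_is_cst 1 0 dh.
    by rewrite /h mul1r mul0r.
  suff cv : u^-1 *: ((h \o shift t) (u *: (1 : R)) - h t) @[u --> 0^'] --> (0 : R).
    by apply: DeriveDef; [apply/cvg_ex; exists 0|exact: cvg_lim].
  apply/cvgrPdist_le => e e0.
  have nz : 0 < normc z + 1 by rewrite ltr_wpDl ?normc_ge0.
  have ez : 0 < e / (normc z + 1) by rewrite divr_gt0.
  have [d d0 Hd] := df (t%:C * z) _ ez.
  have dz : 0 < d / (normc z + 1) by rewrite divr_gt0.
  apply/nbhs_normP; exists (d / (normc z + 1)) => //= u.
  rewrite sub0r normrN => ud u0.
  have {}ud : `|u| < d / (normc z + 1) by move: ud; rewrite /ball_ /= sub0r normrN.
  rewrite -[u *: 1]/(u * 1) mulr1 -[_ *: _]/(_ * _) normrM normfV.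
  rewrite mulrC ler_pdivrMr ?normr_gt0 //; apply: le_trans (Hg _ _) _.
  have E : (u + t)%:C * z - t%:C * z = u%:C * z :> C.
    by rewrite -mulrBl -rmorphB /= addrK.
  have := Hd ((u + t)%:C * z); rewrite E mul0r subr0 normcM normc_realE => H.
  apply: le_trans (H _) _.
    move: ud; rewrite ltr_pdivlMr //; apply: le_lt_trans.
    by rewrite ler_wpM2l ?normr_ge0 // lerDl.
  rewrite mulrA mulrAC ler_wpM2r ?normr_ge0 // mulrAC ler_pdivrMr //.
  by rewrite ler_wpM2l ?lerDl // ltW.
have hR := key (fun z => complex.Re (f z)) (fun u v => ltac:(by rewrite -ReB; exact: Re_le_normc)).
have hI := key (fun z => complex.Im (f z)) (fun u v => ltac:(by rewrite -ImB; exact: Im_le_normc)).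
by apply/eqP; rewrite eq_complex hR hI !eqxx.
Qed.

Lemma diff0_constant (V : normedModType C) (f : V -> C) (x v : V) :
  (forall y, differentiable f y) -> (forall t : C, 'd f (x + t *: v) v = 0) ->
  forall t : C, f (x + t *: v) = f x.
Proof.
move=> df dv t.
have := @cderiv0_constant (fun t : C => f (x + t *: v)) _ t.
rewrite scale0r addr0; apply => z; apply: cderiv_shift.
under eq_fun do rewrite scalerDl addrA.
by have := cderiv_line v (df (x + z *: v)); rewrite dv.
Qed.

(* The differential of a map that is quadratic along lines is read off its
   linear coefficient. *)
Lemma diff_quadratic (V : normedModType C) (f : V -> C) (x v : V) (c0 c1 c2 : C) :
  differentiable f x -> (forall t : C, f (x + t *: v) = c0 + t * (c1 + t * c2)) ->
  'd f x v = c1.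
Proof.
move=> df E; apply: (cderiv_unique (cderiv_line v df)).
under eq_fun do rewrite E.
apply/cderivP; suff [b Hb] : exists b, cderiv (fun t : C => c1 + t * c2) 0 b.
  apply/cderivP => e e0.
  have [d d0 Hd] := continuous_normc (@entire_continuous _ _ (entire_affine c1 c2) 0) e0.
  exists d => // z /Hd; rewrite subr0 mul0r !addr0 => Hz.
  have -> : c0 + z * (c1 + z * c2) - (c0 + 0 * c1) - c1 * z = (c1 + z * c2 - c1) * z.
    by ring.
  by rewrite normcM ler_wpM2r ?normc_ge0 // ltW.
by apply: differentiable_cderiv; exact: entire_affine.
Qed.

End EntireAlgebra.

(** * Linear algebra of singular pencils *)

Section Pencils.
Variable R : realType.
Local Notation C := (Num.NumField.sort (complex R : numFieldType)).

(** The dimension m is tied by an equation rather than substituted, so that the kernels of a and of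
    its transpose get bases of the same type. *)
Lemma kernel_basis (F : fieldType) n (a : 'M[F]_n) (m : nat) :
  m = (n - \rank a)%N -> exists P : 'M[F]_(n, m), [/\ a *m P = 0, row_free P^T &
    forall x : 'cV[F]_n, a *m x = 0 -> exists y, x = P *m y].
Proof.
rewrite -mxrank_tr -mxrank_ker => ->.
exists (row_base (kermx a^T))^T; split.
- apply: trmx_inj; rewrite trmx_mul trmxK trmx0; apply/sub_kermxP.
  by rewrite eq_row_base.
- by rewrite trmxK row_base_free.
move=> x ax; have /submxP[y xy] : (x^T <= row_base (kermx a^T))%MS.
  by rewrite eq_row_base; apply/sub_kermxP; rewrite -trmx_mul ax trmx0.
by exists y^T; rewrite -trmx_mul -xy trmxK.
Qed.

(** Search on the line Z1 + z Z2 through a right inverse of each. If all points failed, then det (1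
    + z P Z2) det (Q Z1 + z) would vanish identically, hence so would the second factor. *)
Lemma common_complement m n (P Q : 'M[C]_(m, n)) : row_free P -> row_free Q ->
  exists Z, (\det (P *m Z) != 0) && (\det (Q *m Z) != 0).
Proof.
move=> /row_freeP[Z1 PZ1] /row_freeP[Z2 QZ2]; apply: contrapT => /forallNP H.
have eZ (U V : 'M[C]_m) : entire (fun t => \det (U + t *: V)).
  by apply: entire_det => i j; under eq_fun do rewrite !mxE; exact: entire_affine.
have h0 t : \det (Q *m Z1 + t *: 1%:M) = 0.
  apply: (entire_mul_eq0 (eZ 1%:M (P *m Z2)) (eZ (Q *m Z1) 1%:M)) => [z|].
    apply/eqP; rewrite mulf_eq0; apply: contrapT => /negP; rewrite negb_or => Hz.
    apply: (H (Z1 + z *: Z2)).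
    by rewrite !mulmxDr -!scalemxAr PZ1 QZ2.
  by rewrite scale0r addr0 det1 oner_neq0.
have : (1 : C) = 0; last by apply/eqP; rewrite oner_eq0.
(* The reversed pencil 1 + z Q Z1 is then singular for z nonzero; the factor z covers z = 0, and the
   conclusion that the identity function is 0 is read at 1. *)
apply: (entire_mul_eq0 (eZ 1%:M (Q *m Z1)) (@entire_id R)) => [z|].
  have [->|z0] := eqVneq z 0; first by rewrite mulr0.
  rewrite (_ : 1%:M + z *: _ = z *: (Q *m Z1 + z^-1 *: 1%:M)).
    by rewrite detZ h0 mulr0 mul0r.
  by rewrite scalerDr scalerA divff // scale1r addrC.
by rewrite scale0r addr0 det1 oner_neq0.
Qed.

(* Every symmetric matrix of rank less than n is of this form over C. *)
Definition sing_sym n (M : 'M[C]_n) : 'M[C]_n := M *m pid_mx n.-1 *m M^T.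

Lemma sing_sym_tr n (M : 'M[C]_n) : (sing_sym M)^T = sing_sym M.
Proof. by rewrite /sing_sym !trmx_mul trmxK tr_pid_mx mulmxA. Qed.

Lemma det_sing_sym n (M : 'M[C]_n) : (0 < n)%N -> \det (sing_sym M) = 0.
Proof.
case: n M => // n M _; rewrite /sing_sym !det_mulmx.
suff -> : \det (pid_mx n.+1.-1 : 'M[C]_n.+1) = 0 by rewrite mulr0 mul0r.
apply/eqP; rewrite -[_ == 0]negbK -unitfE -[_ \is a _]/(_ \in unitmx).
by rewrite -row_free_unit -row_leq_rank rank_pid_mx ?ltnn.
Qed.

(** If a is nonzero, its kernel has dimension m < n. Take S = Z Z^T of rank at most m, with Z
    nondegenerate against the left kernel of a and against b (ker a), on which [full] makes b
    injective: then a + S b is invertible. *)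
Lemma singular_pencil n (a b : 'M[C]_n) :
  (forall q : 'cV[C]_n, a *m q = 0 -> b *m q = 0 -> q = 0) ->
  (forall M, \det (a + sing_sym M *m b) = 0) -> a = 0.
Proof.
move=> full sing; apply/eqP; apply/negPn/negP => a0.
have r0 : (0 < \rank a)%N by rewrite lt0n mxrank_eq0.
pose m := (n - \rank a)%N.
have mn : (m <= n.-1)%N.
  by rewrite /m; have := rank_leq_row a; case: (\rank a) r0 => // r _; lia.
have [P [aP fP kerP]] := @kernel_basis _ n a m erefl.
have [Q' [aQ fQ _]] := @kernel_basis _ n a^T m (f_equal (subn n) (esym (mxrank_tr a))).
have Pinj (y : 'cV[C]_m) : P *m y = 0 -> y = 0.
  move=> Py; have /row_freeP[Z PZ] := fP.
  by rewrite -[y]mul1mx -[1%:M]trmx1 -PZ trmx_mul trmxK -mulmxA Py mulmx0.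
have fbP : row_free (b *m P)^T.
  rewrite -kermx_eq0; apply/eqP/row_matrixP => i; rewrite row0.
  apply: trmx_inj; rewrite trmx0; apply: Pinj; apply: full.
    by rewrite mulmxA aP mul0mx.
  have := congr1 (row i) (mulmx_ker (b *m P)^T); rewrite row_mul row0.
  by move=> /(congr1 trmx); rewrite trmx_mul trmxK trmx0 mulmxA.
have [Z /andP[ZQ ZP]] := common_complement fQ fbP.
pose M := Z *m (pid_mx m : 'M[C]_(m, n)).
(* Since m <= n - 1, the projector in [sing_sym] does not cut anything off. *)
have SE : sing_sym M = Z *m Z^T.
  rewrite /sing_sym /M trmx_mul tr_pid_mx -!mulmxA; congr (_ *m _).
  rewrite !mulmxA !mul_pid_mx.
  rewrite [X in pid_mx X](_ : _ = m) ?pid_mx_1 ?mul1mx //.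
  by move: (leq_pred n); lia.
have := sing M; apply/eqP; rewrite -unitfE -[_ \is a _]/(_ \in unitmx).
rewrite -unitmx_tr -row_free_unit -kermx_eq0; apply/eqP/row_matrixP => i.
rewrite row0; set x := row i _.
have ax : (a + sing_sym M *m b) *m x^T = 0.
  have := congr1 (row i) (mulmx_ker (a + sing_sym M *m b)^T); rewrite row_mul row0.
  by move=> /(congr1 trmx); rewrite trmx_mul trmxK trmx0.
rewrite SE in ax; apply: trmx_inj; rewrite trmx0.
have kill (U : 'M[C]_m) (y : 'cV[C]_m) : \det U != 0 -> U *m y = 0 -> y = 0.
  rewrite -unitfE => Uu Uy; rewrite -[y]mul1mx -(mulVmx Uu).
  by rewrite -mulmxA Uy mulmx0.
(* The left kernel of a kills the first summand of a x + Z Z^T b x, and Q'^T Z is invertible. *)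
have ZbX : Z^T *m b *m x^T = 0.
  apply: (kill _ _ ZQ); have := f_equal (mulmx Q'^T) ax.
  rewrite mulmxDl mulmxDr !mulmxA.
  have -> : Q'^T *m a = 0 by apply: trmx_inj; rewrite trmx_mul trmxK aQ trmx0.
  by rewrite mul0mx add0r mulmx0.
have [y xy] : exists y, x^T = P *m y.
  by apply: kerP; move: ax; rewrite mulmxDl -!mulmxA [Z^T *m _]mulmxA ZbX mulmx0 addr0.
rewrite xy; suff -> : y = 0 by rewrite mulmx0.
apply: (kill (Z^T *m (b *m P))).
  by rewrite -det_tr trmx_mul trmxK.
by rewrite -!mulmxA -xy mulmxA.
Qed.

End Pencils.

(** * Differentials, Jacobians and regular points of row-valued maps *)

Section Contact.
Variable R : realType.
Local Notation C := (Num.NumField.sort (complex R : numFieldType)).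

Section Rows.
Implicit Types (m k n : nat).

Lemma diff_entry m k (f : 'rV[C]_m -> 'rV[C]_k) (x v : 'rV[C]_m) j :
  differentiable f x -> 'd f x v ord0 j = 'd (fun y => f y ord0 j) x v.
Proof.
move=> df; have dc := @differentiable_coord C 1 k (f x) ord0 j.
have -> := f_equal (fun h : 'rV[C]_m -> C => h v) (diff_comp df dc).
rewrite /=; apply/esym; apply: (diff_quadratic (c0 := f x ord0 j) (c2 := 0) dc).
by move=> t; rewrite !mxE mulr0 addr0.
Qed.

Lemma diff_quadratic_row m k (f : 'rV[C]_m -> 'rV[C]_k) (x v : 'rV[C]_m)
    (c0 c1 c2 : 'rV[C]_k) : differentiable f x ->
  (forall t : C, f (x + t *: v) = c0 + t *: (c1 + t *: c2)) -> 'd f x v = c1.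
Proof.
move=> df E; apply/rowP => j; rewrite -[0]/(ord0) diff_entry //.
apply: (diff_quadratic (c0 := c0 ord0 j) (c2 := c2 ord0 j)).
  exact: differentiable_entry.
by move=> t; rewrite E !mxE.
Qed.

Lemma holomorphic_comp m k l (f : 'rV[C]_k -> 'rV[C]_l) (g : 'rV[C]_m -> 'rV[C]_k) :
  holomorphic f -> holomorphic g -> holomorphic (f \o g).
Proof. by move=> hf hg x; apply: differentiable_comp; [exact: hg|exact: hf]. Qed.

Lemma diff_compE m k l (f : 'rV[C]_k -> 'rV[C]_l) (g : 'rV[C]_m -> 'rV[C]_k) x v :
  holomorphic f -> holomorphic g -> 'd (f \o g) x v = 'd f (g x) ('d g x v).
Proof. by move=> hf hg; rewrite diff_comp. Qed.

Lemma differentiable_row_constant m k (f : 'rV[C]_m -> 'rV[C]_k) x v :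
  holomorphic f -> (forall t : C, 'd f (x + t *: v) v = 0) ->
  forall t : C, f (x + t *: v) = f x.
Proof.
move=> hf dv t; apply/rowP => j; rewrite -[0]/(ord0).
apply: (@diff0_constant _ _ (fun y => f y ord0 j)) => [y|s].
  exact: differentiable_entry.
by rewrite -diff_entry // dv mxE.
Qed.

Lemma diff_jacobian m k (f : 'rV[C]_m -> 'rV[C]_k) x v :
  differentiable f x -> 'd f x v = v *m jacobian f x.
Proof. by move=> df; rewrite -deriveEjacobian // deriveE. Qed.

Lemma RegP n (f : 'rV[C]_n -> 'rV[C]_n) x : holomorphic f ->
  Reg f x <-> \det (jacobian f x) != 0.
Proof.
move=> hf; rewrite -unitfE -[_ \is a _]/(_ \in unitmx).
have dE := fun v => diff_jacobian v (hf x).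
split=> [[g fK gK]|uJ].
  rewrite -row_full_unit; apply/row_fullP.
  exists (\matrix_i g (row i 1%:M)); apply/row_matrixP => i.
  by rewrite row_mul rowK -dE gK.
by exists (mulmx^~ (invmx (jacobian f x))) => v; rewrite dE ?mulmxK ?mulmxKV.
Qed.

Lemma entire_jacobian m k (f : 'rV[C]_m -> 'rV[C]_k) x v : holomorphic f ->
  forall i j, entire (fun t : C => jacobian f (x + t *: v) i j).
Proof.
move=> hf i j.
have E y : jacobian f y i j = 'd (fun z => f z ord0 j) y (delta_mx ord0 i).
  by rewrite -diff_entry // diff_jacobian // -rowE [RHS]mxE.
under eq_fun do rewrite E.
by apply: entire_differential => y; exact: differentiable_entry.
Qed.

(** If a nonempty open set contained no regular point, then on the line from one of its points to x0
    the entire function det would vanish near 0, hence also at x0. *)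
Lemma dense_RegP n (f : 'rV[C]_n -> 'rV[C]_n) : holomorphic f ->
  dense (Reg f) <-> exists x, \det (jacobian f x) != 0.
Proof.
move=> hf; split=> [dR|[x0 dx0] O [y Oy] oO].
  have [x [_ /RegP-/(_ hf)]] := dR setT (ex_intro _ 0 I) openT.
  by exists x.
apply: contrapT => H.
have det0 : forall t : C, \det (jacobian f (y + t *: (x0 - y))) = 0.
  have eD : entire (fun t : C => \det (jacobian f (y + t *: (x0 - y)))).
    by apply: entire_det => i j; exact: entire_jacobian.
  have nO : nbhs (0 : C) [set t | O (y + t *: (x0 - y))].
    have := differentiable_continuous (@differentiable_line R _ y (x0 - y) 0).
    apply; rewrite scale0r addr0; exact: open_nbhs_nbhs.
  have /nbhs_normc[d d0 Hd] := nO.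
  apply: (entire_zero eD d0) => t td; apply/eqP/negPn/negP => dt.
  apply: H; exists (y + t *: (x0 - y)); split; last exact/(RegP _ hf).
  by apply: Hd; rewrite subr0.
by move: dx0; have := det0 1; rewrite scale1r addrC subrK => ->; rewrite eqxx.
Qed.

End Rows.
End Contact.

(** * Contact hyperplanes and quadratic Legendrian test maps *)

Section Legendrian.
Variable R : realType.
Local Notation C := (Num.NumField.sort (complex R : numFieldType)).
Variable n : nat.
Local Notation V := 'rV[C]_(n + 1 + n).
Implicit Types (p q w : V) (x v t b : 'rV[C]_n) (A B : 'M[C]_n).

Definition dot t b : C := \sum_i t ord0 i * b ord0 i.

Lemma dotC t b : dot t b = dot b t.
Proof. by apply: eq_bigr => i _; rewrite mulrC. Qed.

Lemma dotDl t t' b : dot (t + t') b = dot t b + dot t' b.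
Proof. by rewrite /dot -big_split /=; apply: eq_bigr => i _; rewrite mxE mulrDl. Qed.

Lemma dotZl (a : C) t b : dot (a *: t) b = a * dot t b.
Proof. by rewrite /dot mulr_sumr; apply: eq_bigr => i _; rewrite mxE mulrA. Qed.

Lemma dotDr t b b' : dot t (b + b') = dot t b + dot t b'.
Proof. by rewrite dotC dotDl !(dotC t). Qed.

Lemma dotZr (a : C) t b : dot t (a *: b) = a * dot t b.
Proof. by rewrite dotC dotZl dotC. Qed.

Lemma dot0l b : dot 0 b = 0.
Proof. by apply: big1 => i _; rewrite mxE mul0r. Qed.

Lemma dot0r b : dot b 0 = 0.
Proof. by rewrite dotC dot0l. Qed.

Lemma dot_delta t i : dot t (delta_mx ord0 i) = t ord0 i.
Proof.
rewrite /dot (bigD1 i) //= mxE !eqxx mulr1 big1 ?addr0 // => j ji.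
by rewrite mxE eqxx (negbTE ji) mulr0.
Qed.

Lemma dot_mulmx t b A B : A *m B^T = B *m A^T -> dot (t *m A) (b *m B) = dot (t *m B) (b *m A).
Proof.
have dE u v : dot u v = (u *m v^T) ord0 ord0.
  by rewrite mxE; apply: eq_bigr => i _; rewrite mxE.
by move=> AB; rewrite !dE !trmx_mul !mulmxA -[t *m A *m _]mulmxA AB mulmxA.
Qed.

Definition tpart p : 'rV[C]_n := lsubmx (lsubmx p).
Definition apart p : C := rsubmx (lsubmx p) ord0 ord0.
Definition bpart p : 'rV[C]_n := rsubmx p.

Lemma tpart_triple t a b : tpart (triple t a b) = t.
Proof. by rewrite /tpart /triple !row_mxKl. Qed.

Lemma apart_triple t a b : apart (triple t a b) = a.
Proof. by rewrite /apart /triple row_mxKl row_mxKr mxE eqxx. Qed.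

Lemma bpart_triple t a b : bpart (triple t a b) = b.
Proof. by rewrite /bpart /triple row_mxKr. Qed.

Definition tripleE := (tpart_triple, apart_triple, bpart_triple).

Lemma triple_eta p : triple (tpart p) (apart p) (bpart p) = p.
Proof.
rewrite /triple -[RHS]hsubmxK; congr row_mx; rewrite -[RHS]hsubmxK; congr row_mx.
by apply/rowP => i; rewrite !ord1 mxE eqxx.
Qed.

Lemma triple_eq p q : tpart p = tpart q -> apart p = apart q -> bpart p = bpart q -> p = q.
Proof. by move=> tE aE bE; rewrite -[p]triple_eta tE aE bE triple_eta. Qed.

Lemma tripleD t a b t' a' b' :
  triple t a b + triple t' a' b' = triple (t + t') (a + a') (b + b').
Proof. by rewrite /triple !add_row_mx raddfD. Qed.

Lemma tripleZ (c : C) t a b : c *: triple t a b = triple (c *: t) (c * a) (c *: b).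
Proof. by rewrite /triple !scale_row_mx scale_scalar_mx. Qed.

Lemma tpartD p q : tpart (p + q) = tpart p + tpart q.
Proof. by rewrite /tpart !raddfD. Qed.

Lemma bpartD p q : bpart (p + q) = bpart p + bpart q.
Proof. by rewrite /bpart raddfD. Qed.

Lemma apartD p q : apart (p + q) = apart p + apart q.
Proof. by rewrite /apart !mxE. Qed.

Lemma tpartZ (c : C) p : tpart (c *: p) = c *: tpart p.
Proof. by rewrite /tpart !linearZ. Qed.

Lemma bpartZ (c : C) p : bpart (c *: p) = c *: bpart p.
Proof. by rewrite /bpart linearZ. Qed.

Lemma apartZ (c : C) p : apart (c *: p) = c * apart p.
Proof. by rewrite /apart !mxE. Qed.

(** The contact hyperplane at p, that is, the kernel of da - b.dtheta. *)
Definition xi p w := apart w = dot (bpart p) (tpart w).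

Lemma xiD p w w' : xi p w -> xi p w' -> xi p (w + w').
Proof. by rewrite /xi => h h'; rewrite apartD tpartD dotDr h h'. Qed.

Lemma xiZ p (c : C) w : xi p w -> xi p (c *: w).
Proof. by rewrite /xi => h; rewrite apartZ tpartZ dotZr h. Qed.

Lemma tpartE p j : tpart p ord0 j = p ord0 (lshift n (lshift 1 j)).
Proof. by rewrite /tpart !mxE. Qed.

Lemma bpartE p j : bpart p ord0 j = p ord0 (rshift (n + 1) j).
Proof. by rewrite /bpart !mxE. Qed.

Lemma apartE p : apart p = p ord0 (lshift n (rshift n ord0)).
Proof. by rewrite /apart !mxE. Qed.

Section Maps.
Variable m : nat.
Variable Phi : 'rV[C]_m -> V.
Hypothesis hPhi : holomorphic Phi.

Lemma holomorphic_tpart : holomorphic (fun z => tpart (Phi z)).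
Proof.
move=> y; apply: differentiable_row => j.
under eq_fun do rewrite tpartE; exact: differentiable_entry.
Qed.

Lemma holomorphic_bpart : holomorphic (fun z => bpart (Phi z)).
Proof.
move=> y; apply: differentiable_row => j.
under eq_fun do rewrite bpartE; exact: differentiable_entry.
Qed.

Lemma differentiable_apart (y : 'rV[C]_m) : differentiable (fun z => apart (Phi z)) y.
Proof. by under eq_fun do rewrite apartE; exact: differentiable_entry. Qed.

Lemma diff_tpart (y u : 'rV[C]_m) :
  'd (fun z => tpart (Phi z)) y u = tpart ('d Phi y u).
Proof.
apply/rowP => j; rewrite -[0]/(ord0) diff_entry; last exact: holomorphic_tpart.
rewrite tpartE diff_entry; last exact: hPhi.
by under eq_fun do rewrite tpartE.
Qed.

Lemma diff_bpart (y u : 'rV[C]_m) :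
  'd (fun z => bpart (Phi z)) y u = bpart ('d Phi y u).
Proof.
apply/rowP => j; rewrite -[0]/(ord0) diff_entry; last exact: holomorphic_bpart.
rewrite bpartE diff_entry; last exact: hPhi.
by under eq_fun do rewrite bpartE.
Qed.

Lemma diff_apart (y u : 'rV[C]_m) :
  'd (fun z => apart (Phi z)) y u = apart ('d Phi y u).
Proof.
rewrite apartE diff_entry; last exact: hPhi.
by under eq_fun do rewrite apartE.
Qed.

End Maps.

Lemma creativeP (Phi : 'rV[C]_n -> V) : holomorphic Phi ->
  creative Phi <-> forall x v, xi (Phi x) ('d Phi x v).
Proof.
move=> hP; have hT := holomorphic_tpart hP.
have E x v : dot (bpart (Phi x)) (tpart ('d Phi x v)) =
    \sum_(i < n) coordf (b_part Phi) i x * 'd (coordf (theta_part Phi) i) x v.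
  by apply: eq_bigr => i _; rewrite -diff_tpart // diff_entry.
by split=> H x v; have := H x v; rewrite /xi -diff_apart // E.
Qed.

Lemma holomorphic_affine_row (c : 'rV[C]_n) A : holomorphic (fun x => c + x *m A).
Proof.
move=> x; apply: differentiable_row => j.
have -> : (fun y => (c + y *m A) ord0 j) =
    cst (c ord0 j) + \sum_(i < n) (fun y : 'rV[C]_n => y ord0 i) * cst (A i j).
  apply/funext => y; rewrite !mxE fctE fct_sumE; congr (_ + _).
apply: differentiableD; first exact: differentiable_cst.
apply: differentiable_sum => i; apply: differentiableM.
  exact: differentiable_coord.
exact: differentiable_cst.
Qed.

(** The quadratic Legendrian map through p whose tangent plane at p is spanned by the rows of (A,
    B). The middle component integrates b.dtheta, which is possible when A B^T is symmetric. *)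
Definition Psi p A B x : V :=
  triple (tpart p + x *m A)
    (apart p + dot (bpart p) (x *m A) + 2^-1 * dot (x *m A) (x *m B))
    (bpart p + x *m B).

Lemma differentiable_dot m (f g : 'rV[C]_m -> 'rV[C]_n) (x : 'rV[C]_m) :
  holomorphic f -> holomorphic g -> differentiable (fun y => dot (f y) (g y)) x.
Proof.
move=> hf hg.
have -> : (fun y => dot (f y) (g y)) =
    \sum_(i < n) (fun y => f y ord0 i) * (fun y => g y ord0 i).
  by apply/funext => y; rewrite fct_sumE.
by apply: differentiable_sum => i; apply: differentiableM; exact: differentiable_entry.
Qed.

Lemma holomorphic_cst m k (c : 'rV[C]_k) : holomorphic (fun _ : 'rV[C]_m => c).
Proof. by move=> x; exact: differentiable_cst. Qed.

Lemma holomorphic_mulmx A : holomorphic (fun x : 'rV[C]_n => x *m A).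
Proof.
have := holomorphic_affine_row 0 A; congr holomorphic.
by apply/funext => x; rewrite add0r.
Qed.

Lemma holomorphic_Psi p A B : holomorphic (Psi p A B).
Proof.
apply: holomorphic_triple; try exact: holomorphic_affine_row.
move=> x; apply: differentiableD; first apply: differentiableD.
- exact: differentiable_cst.
- by apply: differentiable_dot; [exact: holomorphic_cst|exact: holomorphic_mulmx].
apply: differentiableM; first exact: differentiable_cst.
by apply: differentiable_dot; exact: holomorphic_mulmx.
Qed.

Lemma diff_Psi p A B x v : A *m B^T = B *m A^T ->
  'd (Psi p A B) x v = triple (v *m A) (dot (bpart p + x *m B) (v *m A)) (v *m B).
Proof.
move=> AB; apply: (diff_quadratic_row (c0 := Psi p A B x)
  (c2 := triple 0 (2^-1 * dot (v *m A) (v *m B)) 0)); first exact: holomorphic_Psi.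
move=> t; rewrite /Psi !(tripleZ, tripleD) scaler0 addr0 !mulmxDl -!scalemxAl.
rewrite addr0; congr triple; rewrite ?addrA //.
(* Symmetry of A B^T merges the two halves of the cross term into the full (x B).(v A). *)
have h1 := dot_mulmx x v AB; have h2 := dotC (v *m A) (x *m B).
rewrite !(dotDl, dotDr, dotZl, dotZr) h1 h2.
by field.
Qed.

Lemma Psi_creative p A B : A *m B^T = B *m A^T -> creative (Psi p A B).
Proof.
move=> AB; apply/creativeP => [|x v]; first exact: holomorphic_Psi.
by rewrite /xi diff_Psi // !tripleE.
Qed.

Lemma Psi0 p A B : Psi p A B 0 = p.
Proof. by rewrite /Psi !mul0mx !addr0 dot0r dot0l mulr0 !addr0 triple_eta. Qed.

Lemma jacobian_tPsi p A B x : A *m B^T = B *m A^T ->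
  jacobian (fun x => tpart (Psi p A B x)) x = A.
Proof.
move=> AB; have hP := @holomorphic_Psi p A B.
apply/row_matrixP => i; rewrite rowE -diff_jacobian; last exact: holomorphic_tpart.
by rewrite diff_tpart // diff_Psi // tripleE -rowE.
Qed.

Lemma jacobian_bPsi p A B x : A *m B^T = B *m A^T ->
  jacobian (fun x => bpart (Psi p A B x)) x = B.
Proof.
move=> AB; have hP := @holomorphic_Psi p A B.
apply/row_matrixP => i; rewrite rowE -diff_jacobian; last exact: holomorphic_bpart.
by rewrite diff_bpart // diff_Psi // tripleE -rowE.
Qed.

Lemma GX_iff (Phi : 'rV[C]_n -> V) : holomorphic Phi -> creative Phi ->
  GX (complex R) n Phi <->
  (exists x, \det (jacobian (fun x => tpart (Phi x)) x) != 0) /\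
  (exists x, \det (jacobian (fun x => bpart (Phi x)) x) != 0).
Proof.
move=> hP cP; have hT := dense_RegP (holomorphic_tpart hP).
have hB := dense_RegP (holomorphic_bpart hP).
split=> [[_ _ d1 d2]|[d1 d2]]; first exact: conj (proj1 hT d1) (proj1 hB d2).
exact: And4 hP cP (proj2 hT d1) (proj2 hB d2).
Qed.

End Legendrian.

(** * Maps preserving both Legendrian foliations and fixing Y *)

Section Rigidity.
Variable R : realType.
Local Notation C := (Num.NumField.sort (complex R : numFieldType)).
Variable n : nat.
Local Notation V := 'rV[C]_(n + 1 + n).
Implicit Types (p q w : V) (x v t b u : 'rV[C]_n).

(** The dual of the coordinate a: on contact vectors its differential is theta.db, so b and [cpart]
    label the leaves of the second foliation. *)
Definition cpart p : C := dot (bpart p) (tpart p) - apart p.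

Definition legendre_pt p : V := triple (bpart p) (cpart p) (tpart p).

Lemma legendre_ptK p : legendre_pt (legendre_pt p) = p.
Proof.
apply: triple_eq; rewrite /legendre_pt /cpart !tripleE //.
by rewrite dotC; ring.
Qed.

Lemma eq_dot (t t' : 'rV[C]_n) : (forall v, dot t v = dot t' v) -> t = t'.
Proof. by move=> H; apply/rowP => i; rewrite -[0]/(ord0) -!dot_delta H. Qed.

(* For u.u = t.t - 2a, the b-leaf through (t, a, t + u) meets the graph
   {(s, s.s/2, s)} at s = t + u; comparing u and -u pins down the image. *)
Lemma rigid (G : V -> V) : (0 < n)%N ->
  (forall t a b b', tpart (G (triple t a b)) = tpart (G (triple t a b'))) ->
  (forall t a b b', apart (G (triple t a b)) = apart (G (triple t a b'))) ->
  (forall t a b v, bpart (G (triple (t + v) (a + dot b v) b)) =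
    bpart (G (triple t a b))) ->
  (forall t a b v, cpart (G (triple (t + v) (a + dot b v) b)) =
    cpart (G (triple t a b))) ->
  (forall t, G (triple t (2^-1 * dot t t) t) = triple t (2^-1 * dot t t) t) ->
  forall p, G p = p.
Proof.
move=> n0 hT hA hB hC hY.
have taE t a b : tpart (G (triple t a b)) = t /\ apart (G (triple t a b)) = a.
  have [->|aN] := eqVneq a (2^-1 * dot t t).
    by rewrite (hT _ _ b t) (hA _ _ b t) hY !tripleE.
  pose rho : C := dot t t - 2 * a.
  have rho0 : rho != 0.
    apply: contraNneq aN => rho0; apply/eqP.
    have -> : a = 2^-1 * (dot t t - rho) by rewrite /rho; field.
    by rewrite rho0 subr0.
  set T := tpart (G (triple t a b)); set A := apart (G (triple t a b)).
  have key u : dot u u = rho -> dot (t + u) T - A = 2^-1 * dot (t + u) (t + u).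
    move=> uu; have aE : a + dot (t + u) u = 2^-1 * dot (t + u) (t + u).
      rewrite !(dotDl, dotDr) (dotC u t) uu (_ : a = 2^-1 * (dot t t - rho)).
        by field.
      by rewrite /rho; field.
    have := hB t a (t + u) u; have := hC t a (t + u) u.
    rewrite aE hY {1}/cpart !tripleE => cE bE; move: cE; rewrite /cpart -bE.
    rewrite (hT _ _ _ b) (hA _ _ _ b) -/T -/A => <-.
    by field.
  (* A square root always exists over C; it provides the vectors u = s e_i and -s e_i with u.u =
     rho. *)
  pose s : C := sqrtc rho.
  have ss : s * s = rho by rewrite -expr2; exact: sqr_sqrtc.
  have s0 : s != 0.
    by apply: contraNneq rho0 => s0; rewrite -ss s0 mul0r.
  have TE : T = t.
    apply/rowP => i; rewrite -[0]/(ord0) -!dot_delta.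
    have ee : dot (s *: delta_mx ord0 i) (s *: delta_mx ord0 i) = rho.
      by rewrite dotZl dotZr dot_delta mxE !eqxx mulr1.
    have eeN : dot (- s *: delta_mx ord0 i) (- s *: delta_mx ord0 i) = rho.
      by rewrite dotZl dotZr dot_delta mxE !eqxx mulr1 mulrNN.
    have := key _ ee; have := key _ eeN.
    rewrite !(dotDl, dotDr, dotZl, dotZr) !(dotC (delta_mx ord0 i) t)
      !(dotC (delta_mx ord0 i) T) => k2 k1.
    apply: (mulfI s0); have h2 : (2 : C) != 0 by rewrite pnatr_eq0.
    apply: (mulfI h2); move: k1 k2.
    move: (dot t T) (dot T (delta_mx _ _)) (dot t (delta_mx _ _)) (dot t t)
      (dot (delta_mx _ _) _) => c1 c2 c3 c4 c5 k1 k2.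
    have k3 : (c1 + s * c2 - A) - (c1 + - s * c2 - A) = 2 * (s * c3).
      by rewrite k1 k2; field.
    by rewrite -k3; ring.
  have e0 : exists u, dot u u = rho.
    exists (s *: delta_mx ord0 (Ordinal n0)).
    by rewrite dotZl dotZr dot_delta mxE !eqxx mulr1.
  split => //; have [u uu] := e0; have := key u uu; rewrite TE !(dotDl, dotDr) uu.
  rewrite (dotC u t) => k; have -> : A = dot t t + dot t u - (dot t t + dot t u - A) by ring.
  by rewrite k /rho; field.
move=> p; rewrite -[p]triple_eta; move: (tpart p) (apart p) (bpart p) => t a b.
have [tE aE] := taE t a b.
apply: triple_eq; rewrite ?tE ?aE !tripleE //.
(* With theta, a and the b-part X of the image known, constancy of [cpart] along the leaf reads X.(t
   + v) - (a + b.v) = X.t - a, that is, X.v = b.v. *)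
apply: eq_dot => v; have := hC t a b v.
have [tE' aE'] := taE (t + v) (a + dot b v) b.
rewrite /cpart (hB t a b v) tE' aE' tE aE dotDr => h.
set X := bpart _ in h *.
have -> : dot X v = (dot X t + dot X v - (a + dot b v)) - (dot X t - a) + dot b v by ring.
by rewrite h; ring.
Qed.

End Rigidity.

(** * A contact involution compatible with GX is the identity or Legendre *)

Section ContactInvolution.
Variable R : realType.
Local Notation C := (Num.NumField.sort (complex R : numFieldType)).
Variable n : nat.
Hypothesis n0 : (0 < n)%N.
Local Notation V := 'rV[C]_(n + 1 + n).
Implicit Types (p q w : V) (A B M N : 'M[C]_n).

Variable F : V -> V.
Hypothesis hF : holomorphic F.
Hypothesis FK : forall p, F (F p) = p.
Hypothesis F_contact : forall p w, xi p w -> xi (F p) ('d F p w).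
Hypothesis F_GX : forall Phi : 'rV[C]_n -> V, GX (complex R) n Phi ->
  GX (complex R) n (F \o Phi).
Hypothesis F_fix : forall t : 'rV[C]_n,
  F (triple t (2^-1 * dot t t) t) = triple t (2^-1 * dot t t) t.
Hypothesis F_neq_id : exists p, F p <> p.

Definition tframe p (t : 'rV[C]_n) : V := triple t (dot (bpart p) t) 0.
Definition bframe (b : 'rV[C]_n) : V := triple 0 0 b.

Lemma xi_frame p w : xi p w -> w = tframe p (tpart w) + bframe (bpart w).
Proof.
by move=> pw; rewrite /tframe /bframe tripleD !addr0 add0r -pw triple_eta.
Qed.

Lemma xi_tframe p t : xi p (tframe p t).
Proof. by rewrite /xi !tripleE. Qed.

Lemma xi_bframe p b : xi p (bframe b).
Proof. by rewrite /xi !tripleE dot0r. Qed.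

(** Blocks of dF on the contact hyperplane, acting on rows from the right: the first letter is the
    component of the image, the second the frame direction. In the order [dFtt], [dFtb], [dFbt],
    [dFbb] they are the A, B, C, D of the overview. *)
Definition dFtt p : 'M[C]_n := \matrix_i tpart ('d F p (tframe p (delta_mx ord0 i))).
Definition dFtb p : 'M[C]_n := \matrix_i tpart ('d F p (bframe (delta_mx ord0 i))).
Definition dFbt p : 'M[C]_n := \matrix_i bpart ('d F p (tframe p (delta_mx ord0 i))).
Definition dFbb p : 'M[C]_n := \matrix_i bpart ('d F p (bframe (delta_mx ord0 i))).

Lemma rows_linear (g : 'rV[C]_n -> 'rV[C]_n) :
  (forall t t', g (t + t') = g t + g t') -> (forall (c : C) t, g (c *: t) = c *: g t) ->
  forall t, g t = t *m \matrix_i g (delta_mx ord0 i).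
Proof.
move=> gD gZ t; rewrite mulmx_sum_row {1}[t]row_sum_delta.
have g0 : g 0 = 0 by have := gZ 0 0; rewrite !scale0r.
rewrite (big_morph g gD g0); apply: eq_bigr => i _.
by rewrite gZ rowK.
Qed.

Lemma tframeD p t t' : tframe p (t + t') = tframe p t + tframe p t'.
Proof. by rewrite /tframe tripleD dotDr addr0. Qed.

Lemma tframeZ p (c : C) t : tframe p (c *: t) = c *: tframe p t.
Proof. by rewrite /tframe tripleZ dotZr scaler0. Qed.

Lemma bframeD b b' : bframe (b + b') = bframe b + bframe b'.
Proof. by rewrite /bframe tripleD !addr0. Qed.

Lemma bframeZ (c : C) b : bframe (c *: b) = c *: bframe b.
Proof. by rewrite /bframe tripleZ mulr0 scaler0. Qed.

Lemma tpart_dF p w : xi p w ->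
  tpart ('d F p w) = tpart w *m dFtt p + bpart w *m dFtb p.
Proof.
move=> /xi_frame wE; rewrite {1}wE linearD tpartD; congr (_ + _).
  apply: (rows_linear (g := fun t => tpart ('d F p (tframe p t)))) => [t t'|c t].
    by rewrite tframeD linearD tpartD.
  by rewrite tframeZ linearZ tpartZ.
apply: (rows_linear (g := fun t => tpart ('d F p (bframe t)))) => [t t'|c t].
  by rewrite bframeD linearD tpartD.
by rewrite bframeZ linearZ tpartZ.
Qed.

Lemma bpart_dF p w : xi p w ->
  bpart ('d F p w) = tpart w *m dFbt p + bpart w *m dFbb p.
Proof.
move=> /xi_frame wE; rewrite {1}wE linearD bpartD; congr (_ + _).
  apply: (rows_linear (g := fun t => bpart ('d F p (tframe p t)))) => [t t'|c t].
    by rewrite tframeD linearD bpartD.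
  by rewrite tframeZ linearZ bpartZ.
apply: (rows_linear (g := fun t => bpart ('d F p (bframe t)))) => [t t'|c t].
  by rewrite bframeD linearD bpartD.
by rewrite bframeZ linearZ bpartZ.
Qed.

Lemma creative_comp (Phi : 'rV[C]_n -> V) : holomorphic Phi -> creative Phi ->
  creative (F \o Phi).
Proof.
move=> hP /(creativeP hP) cP; apply/creativeP => [|x v].
  exact: holomorphic_comp.
by rewrite diff_compE //; exact: F_contact.
Qed.

(** The two factors are the Jacobian determinants at 0 of the parts of F o Psi. Were both nonzero, F
    o Psi and then Psi itself would lie in GX; but the Jacobians of Psi are constantly A and B. *)
Lemma det_degenerate p A B : A *m B^T = B *m A^T -> \det A * \det B = 0 ->
  \det (A *m dFtt p + B *m dFtb p) * \det (A *m dFbt p + B *m dFbb p) = 0.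
Proof.
move=> AB AB0; have hP := @holomorphic_Psi R n p A B.
have cP := @Psi_creative R n p A B AB.
have hFP := holomorphic_comp hF hP; have cFP := creative_comp hP cP.
have jt : jacobian (fun x => tpart ((F \o Psi p A B) x)) 0 = A *m dFtt p + B *m dFtb p.
  apply/row_matrixP => i; rewrite rowE -diff_jacobian; last exact: holomorphic_tpart.
  rewrite diff_tpart // diff_compE // Psi0 diff_Psi // mul0mx addr0.
  rewrite tpart_dF; last by rewrite /xi !tripleE.
  by rewrite !tripleE -!mulmxA -mulmxDr -rowE.
have jb : jacobian (fun x => bpart ((F \o Psi p A B) x)) 0 = A *m dFbt p + B *m dFbb p.
  apply/row_matrixP => i; rewrite rowE -diff_jacobian; last exact: holomorphic_bpart.
  rewrite diff_bpart // diff_compE // Psi0 diff_Psi // mul0mx addr0.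
  rewrite bpart_dF; last by rewrite /xi !tripleE.
  by rewrite !tripleE -!mulmxA -mulmxDr -rowE.
apply/eqP; apply: contrapT => /negP; rewrite mulf_eq0 negb_or => /andP[d1 d2].
have x1 : exists x, \det (jacobian (fun x => tpart ((F \o Psi p A B) x)) x) != 0.
  by rewrite -jt in d1; exact: (ex_intro _ 0 d1).
have x2 : exists x, \det (jacobian (fun x => bpart ((F \o Psi p A B) x)) x) != 0.
  by rewrite -jb in d2; exact: (ex_intro _ 0 d2).
have := proj2 (GX_iff hFP cFP) (conj x1 x2).
move=> /F_GX; have -> : F \o (F \o Psi p A B) = Psi p A B.
  by apply/funext => x /=; rewrite FK.
move=> /(proj1 (GX_iff hP cP))[[x]]; rewrite jacobian_tPsi // => dA.
move=> [y]; rewrite jacobian_bPsi // => dB.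
by move/eqP: AB0; rewrite mulf_eq0 (negbTE dA) (negbTE dB).
Qed.

Definition line_entire (g : V -> 'M[C]_n -> C) := forall p q M N,
  entire (fun t : C => g (p + t *: q) (M + t *: N)).

(** Join a point where g does not vanish to an arbitrary one. Point and matrix vary together, so
    that the alternative is the same for all p. *)
Lemma line_entire_mul_eq0 g h : line_entire g -> line_entire h ->
  (forall p M, g p M * h p M = 0) ->
  (forall p M, g p M = 0) \/ (forall p M, h p M = 0).
Proof.
move=> eg eh gh; have [|/existsNP[p /existsNP[M gpM]]] := pselect (forall p M, g p M = 0).
  by left.
right => q N.
have E1 : p + 1 *: (q - p) = q by rewrite scale1r addrC subrK.
have E2 : M + 1 *: (N - M) = N by rewrite scale1r addrC subrK.
have := entire_mul_eq0 (eg p (q - p) M (N - M)) (eh p (q - p) M (N - M)).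
move=> /(_ (fun z => gh _ _)) H; rewrite -E1 -E2; apply: H.
by rewrite !scale0r !addr0; apply/eqP.
Qed.

Lemma entire_dF p q w j : entire (fun t : C => 'd F (p + t *: q) w ord0 j).
Proof.
under eq_fun do rewrite diff_entry //.
by apply: entire_differential => y; exact: differentiable_entry.
Qed.

(** The frame moves affinely with the base point, which keeps the blocks of dF entire along
    lines. *)
Lemma tframe_line p q v (t : C) : tframe (p + t *: q) v =
  triple v (dot (bpart p) v) 0 + (t * dot (bpart q) v) *: triple 0 1 0.
Proof.
rewrite /tframe bpartD bpartZ dotDl dotZl tripleZ tripleD.
by rewrite !scaler0 !addr0 mulr1.
Qed.

Lemma entire_dF_tframe p q v j :
  entire (fun t : C => 'd F (p + t *: q) (tframe (p + t *: q) v) ord0 j).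
Proof.
under eq_fun do rewrite tframe_line linearD linearZ !mxE.
apply: entireD; first exact: entire_dF.
apply: entireM; last exact: entire_dF.
exact: (entireM (@entire_id R) (entire_cst _)).
Qed.

Lemma entire_tt p q i j : entire (fun t : C => dFtt (p + t *: q) i j).
Proof. by under eq_fun do rewrite mxE tpartE; exact: entire_dF_tframe. Qed.
Lemma entire_bt p q i j : entire (fun t : C => dFbt (p + t *: q) i j).
Proof. by under eq_fun do rewrite mxE bpartE; exact: entire_dF_tframe. Qed.
Lemma entire_tb p q i j : entire (fun t : C => dFtb (p + t *: q) i j).
Proof. by under eq_fun do rewrite mxE tpartE; exact: entire_dF. Qed.
Lemma entire_bb p q i j : entire (fun t : C => dFbb (p + t *: q) i j).
Proof. by under eq_fun do rewrite mxE bpartE; exact: entire_dF. Qed.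

Lemma line_entire_pencil (a b : V -> 'M[C]_n) :
  (forall p q i j, entire (fun t : C => a (p + t *: q) i j)) ->
  (forall p q i j, entire (fun t : C => b (p + t *: q) i j)) ->
  line_entire (fun p M => \det (a p + sing_sym M *m b p)).
Proof.
move=> ea eb p q M N; apply: entire_det => i j.
under eq_fun do rewrite mxE; apply: entireD; first exact: ea.
apply: entire_mulmx => // {}i {}j; rewrite /sing_sym.
have eM k l : entire (fun t : C => (M + t *: N) k l).
  by under eq_fun do rewrite !mxE; exact: entire_affine.
apply: entire_mulmx; last by move=> k l; under eq_fun do rewrite mxE; exact: eM.
apply: entire_mulmx; [exact: eM|move=> k l; exact: entire_cst].
Qed.

(** Differentiating F o F = id shows that dF at F p inverts dF at p, and it preserves contact
    vectors. *)
Lemma dFK p z : xi (F p) z -> exists2 w, xi p w & 'd F p w = z.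
Proof.
move=> pz; exists ('d F (F p) z); first by have := F_contact pz; rewrite FK.
have := @diff_compE R _ _ _ F F (F p) z hF hF; rewrite FK => <-.
apply: (diff_quadratic_row (c0 := F p) (c2 := 0)); first exact: holomorphic_comp.
by move=> t; rewrite /= FK scaler0 addr0.
Qed.

(** Such a q annihilates the theta-parts of all images of contact vectors, and by [dFK] these parts
    fill the whole space. *)
Lemma full_t p (q : 'cV[C]_n) : dFtt p *m q = 0 -> dFtb p *m q = 0 -> q = 0.
Proof.
move=> tq bq; apply: trmx_inj; rewrite trmx0; apply: eq_dot => v; rewrite dot0l.
have [w pw wE] := dFK (xi_tframe (F p) v).
have := tpart_dF pw; rewrite wE !tripleE => vE.
have : v *m q = 0 by rewrite vE mulmxDl -!mulmxA tq bq !mulmx0 addr0.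
move=> /matrixP/(_ ord0 ord0); rewrite !mxE => <-.
by apply: eq_bigr => i _; rewrite mxE mulrC.
Qed.

Lemma full_b p (q : 'cV[C]_n) : dFbt p *m q = 0 -> dFbb p *m q = 0 -> q = 0.
Proof.
move=> tq bq; apply: trmx_inj; rewrite trmx0; apply: eq_dot => v; rewrite dot0l.
have [w pw wE] := dFK (xi_bframe (F p) v).
have := bpart_dF pw; rewrite wE !tripleE => vE.
have : v *m q = 0 by rewrite vE mulmxDl -!mulmxA tq bq !mulmx0 addr0.
move=> /matrixP/(_ ord0 ord0); rewrite !mxE => <-.
by apply: eq_bigr => i _; rewrite mxE mulrC.
Qed.

Lemma not_full (a b : 'M[C]_n) :
  (forall q : 'cV[C]_n, a *m q = 0 -> b *m q = 0 -> q = 0) ->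
  a = 0 -> b = 0 -> False.
Proof.
move=> full a0 b0; have := full (const_mx 1); rewrite a0 b0 !mul0mx => /(_ erefl erefl).
by move=> /matrixP/(_ (Ordinal n0) ord0); rewrite !mxE => /eqP; rewrite oner_eq0.
Qed.

(** [X] tests with the planes (1, S), whose b-part is singular, and [Y] with (S, 1), whose
    theta-part is. Of the four combinations, [not_full] excludes the two in which an entire row of
    blocks vanishes. *)
Lemma leaves_dichotomy : ((forall p, dFtb p = 0) /\ (forall p, dFbt p = 0)) \/
  ((forall p, dFtt p = 0) /\ (forall p, dFbb p = 0)).
Proof.
have sym1 M : 1%:M *m (sing_sym M)^T = sing_sym M *m (1%:M : 'M[C]_n)^T.
  by rewrite sing_sym_tr trmx1 mul1mx mulmx1.
have X : (forall p M, \det (dFtt p + sing_sym M *m dFtb p) = 0) \/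
         (forall p M, \det (dFbt p + sing_sym M *m dFbb p) = 0).
  apply: line_entire_mul_eq0 => [||p M].
  - exact: line_entire_pencil entire_tt entire_tb.
  - exact: line_entire_pencil entire_bt entire_bb.
  have := @det_degenerate p _ _ (sym1 M); rewrite !mul1mx; apply.
  by rewrite det_sing_sym // mulr0.
have Y : (forall p M, \det (dFtb p + sing_sym M *m dFtt p) = 0) \/
         (forall p M, \det (dFbb p + sing_sym M *m dFbt p) = 0).
  apply: line_entire_mul_eq0 => [||p M].
  - exact: line_entire_pencil entire_tb entire_tt.
  - exact: line_entire_pencil entire_bb entire_bt.
  have := @det_degenerate p _ _ (esym (sym1 M)).
  rewrite !mul1mx [sing_sym M *m dFtt p + _]addrC [sing_sym M *m dFbt p + _]addrC; apply.
  by rewrite det_sing_sym // mul0r.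
have z1 : (forall p M, \det (dFtt p + sing_sym M *m dFtb p) = 0) -> forall p, dFtt p = 0.
  by move=> H p; exact: singular_pencil (@full_t p) (H p).
have z2 : (forall p M, \det (dFbt p + sing_sym M *m dFbb p) = 0) -> forall p, dFbt p = 0.
  by move=> H p; exact: singular_pencil (@full_b p) (H p).
have z3 : (forall p M, \det (dFtb p + sing_sym M *m dFtt p) = 0) -> forall p, dFtb p = 0.
  by move=> H p; apply: singular_pencil (H p) => q h1 h2; exact: full_t h2 h1.
have z4 : (forall p M, \det (dFbb p + sing_sym M *m dFbt p) = 0) -> forall p, dFbb p = 0.
  by move=> H p; apply: singular_pencil (H p) => q h1 h2; exact: full_b h2 h1.
case: X Y => [/z1 t0|/z2 b0] [/z3 t1|/z4 b1].
- by case: (not_full (@full_t 0) (t0 0) (t1 0)).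
- by right.
- by left.
- by case: (not_full (@full_b 0) (b0 0) (b1 0)).
Qed.

Lemma line_constant (g : V -> C) p w :
  (forall y, differentiable g y) -> (forall t : C, 'd g (p + t *: w) w = 0) ->
  g (p + w) = g p.
Proof. by move=> dg g0; have := diff0_constant dg g0 1; rewrite scale1r. Qed.

(** Along a contact line the image satisfies da = b.dtheta, so a is constant once theta is. *)
Lemma line_tpart_constant p w : (forall t : C, xi (p + t *: w) w) ->
  (forall t : C, tpart ('d F (p + t *: w) w) = 0) ->
  tpart (F (p + w)) = tpart (F p) /\ apart (F (p + w)) = apart (F p).
Proof.
move=> xw tw; split.
  have := @differentiable_row_constant R _ _ (fun y => tpart (F y)) p w _ _ 1.
  rewrite scale1r; apply; first exact: holomorphic_tpart.
  by move=> t; rewrite diff_tpart // tw.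
apply: (@line_constant (fun y => apart (F y))) => [y|t].
  exact: differentiable_apart.
by rewrite diff_apart //; have := F_contact (xw t); rewrite /xi tw dot0r.
Qed.

Lemma diff_dot_cst m (b : 'rV[C]_n) (f : 'rV[C]_m -> 'rV[C]_n) x v : holomorphic f ->
  'd (fun y => dot b (f y)) x v = dot b ('d f x v).
Proof.
move=> hf.
have df i : differentiable (fun y => f y ord0 i : C) x by exact: differentiable_entry.
have dZ i : differentiable (b ord0 i *: (fun y => f y ord0 i : C)) x.
  exact: differentiableZ.
have -> : (fun y => dot b (f y)) = \sum_(i < n) (b ord0 i *: (fun y => f y ord0 i : C)).
  by apply/funext => y; rewrite fct_sumE.
rewrite (diff_sum_apply v dZ); apply: eq_bigr => i _.
by rewrite (diffZ_apply _ v (df i)) diff_entry.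
Qed.

Lemma line_bpart_constant p w : (forall t : C, xi (p + t *: w) w) ->
  (forall t : C, bpart ('d F (p + t *: w) w) = 0) ->
  bpart (F (p + w)) = bpart (F p) /\ cpart (F (p + w)) = cpart (F p).
Proof.
move=> xw bw; have bE (t : C) : bpart (F (p + t *: w)) = bpart (F p).
  apply: (@differentiable_row_constant R _ _ (fun y => bpart (F y)) p w).
    exact: holomorphic_bpart.
  by move=> s; rewrite diff_bpart // bw.
have bE1 := bE 1; rewrite scale1r in bE1; split=> //; rewrite /cpart bE1.
set b := bpart (F p).
(* Since b is constant along the line, it is frozen before differentiating: d(b.theta - a) =
   b.dtheta - da = 0, without a product rule. *)
pose f1 y : C := dot b (tpart (F y)); pose f2 y : C := apart (F y).
have d1 y : differentiable f1 y.
  by apply: differentiable_dot; [exact: holomorphic_cst|exact: holomorphic_tpart].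
have d2 y : differentiable f2 y by exact: differentiable_apart.
pose g := f1 \- f2.
have dg y : differentiable g y by exact: differentiableB (d1 y) (d2 y).
have g0 (t : C) : 'd g (p + t *: w) w = 0.
  have e1 : 'd f1 (p + t *: w) w = dot b (tpart ('d F (p + t *: w) w)).
    rewrite -(diff_tpart hF); exact: (diff_dot_cst _ _ _ (holomorphic_tpart hF)).
  have e2 : 'd f2 (p + t *: w) w = apart ('d F (p + t *: w) w) := diff_apart hF _ _.
  refine (etrans (diffB_apply w (d1 (p + t *: w)) (d2 (p + t *: w))) _).
  refine (etrans (f_equal2 (fun c c' : C => c - c') e1 e2) _).
  have := F_contact (xw t); rewrite /xi bE => E.
  by apply/eqP; rewrite subr_eq0 E.
exact: line_constant dg g0.
Qed.

Lemma add_bframe t a b b' : triple t a b + bframe (b' - b) = triple t a b'.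
Proof. by rewrite /bframe tripleD !addr0 addrC subrK. Qed.

Lemma add_tframe t a b v :
  triple t a b + tframe (triple t a b) v = triple (t + v) (a + dot b v) b.
Proof. by rewrite /tframe tripleD !tripleE addr0. Qed.

Lemma xi_tframe_line p v (s : C) : xi (p + s *: tframe p v) (tframe p v).
Proof.
by rewrite /xi bpartD bpartZ dotDl dotZl /tframe !tripleE dot0l mulr0 addr0.
Qed.

Lemma contact_involution_legendre p : F p = legendre_pt p.
Proof.
have xb (q : V) b (s : C) : xi (q + s *: bframe b) (bframe b) by exact: xi_bframe.
have [[tb0 bt0]|[tt0 bb0]] := leaves_dichotomy.
  have T (t : 'rV[C]_n) (a : C) b b' : tpart (F (triple t a b')) = tpart (F (triple t a b)) /\
      apart (F (triple t a b')) = apart (F (triple t a b)).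
    rewrite -(add_bframe t a b b'); apply: line_tpart_constant => s; first exact: xb.
    by rewrite tpart_dF // tb0 mulmx0 addr0 /bframe !tripleE mul0mx.
  have B (t : 'rV[C]_n) (a : C) b v :
      bpart (F (triple (t + v) (a + dot b v) b)) = bpart (F (triple t a b)) /\
      cpart (F (triple (t + v) (a + dot b v) b)) = cpart (F (triple t a b)).
    rewrite -add_tframe; apply: line_bpart_constant => s; first exact: xi_tframe_line.
    rewrite bpart_dF; last exact: xi_tframe_line.
    by rewrite bt0 mulmx0 add0r /tframe !tripleE mul0mx.
  (* Both foliations are preserved, so F would be the identity. *)
  have [q] := F_neq_id; case; apply: rigid => //.
  - by move=> t a b b'; have [] := T t a b' b.
  - by move=> t a b b'; have [] := T t a b' b.
  - by move=> t a b v; have [] := B t a b v.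
  - by move=> t a b v; have [] := B t a b v.
have T (t : 'rV[C]_n) (a : C) b b' : bpart (F (triple t a b')) = bpart (F (triple t a b)) /\
    cpart (F (triple t a b')) = cpart (F (triple t a b)).
  rewrite -(add_bframe t a b b'); apply: line_bpart_constant => s; first exact: xb.
  by rewrite bpart_dF // bb0 mulmx0 addr0 /bframe !tripleE mul0mx.
have B (t : 'rV[C]_n) (a : C) b v :
    tpart (F (triple (t + v) (a + dot b v) b)) = tpart (F (triple t a b)) /\
    apart (F (triple (t + v) (a + dot b v) b)) = apart (F (triple t a b)).
  rewrite -add_tframe; apply: line_tpart_constant => s; first exact: xi_tframe_line.
  rewrite tpart_dF; last exact: xi_tframe_line.
  by rewrite tt0 mulmx0 add0r /tframe !tripleE mul0mx.
have cL q : cpart (legendre_pt q) = apart q.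
  by rewrite /cpart /legendre_pt !tripleE /cpart dotC; ring.
(* The foliations are exchanged, and the Legendre map exchanges them back: [rigid] applies to the
   composite, which also fixes Y. *)
rewrite -[F p]legendre_ptK; congr legendre_pt.
apply: (@rigid R n (fun q => legendre_pt (F q)) n0).
- by move=> t a b b'; rewrite /legendre_pt !tripleE; have [] := T t a b' b.
- by move=> t a b b'; rewrite /legendre_pt !tripleE; have [] := T t a b' b.
- by move=> t a b v; rewrite /legendre_pt !tripleE; have [] := B t a b v.
- by move=> t a b v; rewrite !cL; have [] := B t a b v.
move=> t; rewrite F_fix /legendre_pt /cpart !tripleE; congr triple.
by field.
Qed.

End ContactInvolution.

(** * Concrete elements of GX and GY *)

Section TestMaps.
Variable R : realType.
Local Notation C := (Num.NumField.sort (complex R : numFieldType)).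
Variable n : nat.
Local Notation V := 'rV[C]_(n + 1 + n).
Implicit Types (p q w : V).

Lemma Psi_scalar_GX p (c : C) : c != 0 -> GX (complex R) n (Psi p 1%:M c%:M).
Proof.
move=> c0; have AB : (1%:M : 'M[C]_n) *m (c%:M)^T = c%:M *m (1%:M)^T.
  by rewrite tr_scalar_mx trmx1 mul1mx mulmx1.
have hP := @holomorphic_Psi R n p 1%:M c%:M.
apply/(GX_iff hP); first exact: Psi_creative.
split; exists 0; rewrite ?jacobian_tPsi ?jacobian_bPsi //.
  by rewrite det1 oner_neq0.
by rewrite det_scalar expf_neq0.
Qed.

Definition GX_element (Phi : 'rV[C]_n -> V) (h : GX (complex R) n Phi) :
  GX (complex R) n := exist _ Phi (mem_set h).

Lemma diagonal_GY : GY (complex R) n (Psi 0 1%:M 1%:M).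
Proof.
split; first exact: holomorphic_Psi.
exists id; split.
  have hid : holomorphic (id : 'rV[C]_n -> 'rV[C]_n).
    have := @holomorphic_mulmx R n 1%:M.
    by under eq_fun do rewrite mulmx1.
  apply/(dense_RegP hid).
  exists 0; have := @jacobian_tPsi R n 0 1%:M 1%:M 0 erefl.
  under eq_fun do rewrite /Psi tripleE mulmx1 /tpart !raddf0 add0r.
  by move=> ->; rewrite det1 oner_neq0.
apply/funext => x; rewrite /Psi !mulmx1 /tpart /apart /bpart !raddf0 !add0r !mxE.
by rewrite dot0l !add0r /dot; congr triple; congr (_ * _); apply: eq_bigr => i _; rewrite expr2.
Qed.

(** The maps [Psi p 1 c] with c nonzero provide the tangent vectors (v, b.v, c v). The value c = 0
    is excluded by regularity of the b-part, but the difference of c = 2 and c = 1 is (0, 0, v), and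
    together these span the contact hyperplane. *)
Lemma contact_of_preserves (F : V -> V) : holomorphic F ->
  (forall Phi : 'rV[C]_n -> V, GX (complex R) n Phi -> GX (complex R) n (F \o Phi)) ->
  forall p w, xi p w -> xi (F p) ('d F p w).
Proof.
move=> hF FGX p w pw.
have c2 : (2 : C) != 0 by rewrite pnatr_eq0.
have test (c : C) v : c != 0 ->
    xi (F p) ('d F p (triple v (dot (bpart p) v) (c *: v))).
  move=> c0; have hP := @holomorphic_Psi R n p 1%:M c%:M.
  have [hFP cFP _ _] := FGX _ (Psi_scalar_GX p c0).
  have := (proj1 (creativeP hFP) cFP) 0 v.
  rewrite diff_compE // /= Psi0 diff_Psi; last first.
    by rewrite tr_scalar_mx trmx1 mul1mx mulmx1.
  by rewrite mul0mx addr0 mulmx1 mul_mx_scalar.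
have frameb v : xi (F p) ('d F p (triple 0 0 v)).
  have -> : triple 0 0 v = triple v (dot (bpart p) v) (2 *: v) +
      (-1) *: triple v (dot (bpart p) v) (1 *: v).
    rewrite tripleZ tripleD scale1r !scaleN1r mulN1r !subrr.
    by rewrite -{3}[v]scale1r -scalerBl (_ : 2 - 1 = 1) ?scale1r //; ring.
  rewrite linearD linearZ; apply: xiD; first exact: test.
  by apply: xiZ; apply: test; rewrite oner_neq0.
have -> : w = triple (tpart w) (dot (bpart p) (tpart w)) (1 *: tpart w) +
    triple 0 0 (bpart w - tpart w).
  by rewrite tripleD !addr0 scale1r addrC subrK -pw triple_eta.
rewrite linearD; apply: xiD; last exact: frameb.
by apply: test; rewrite oner_neq0.
Qed.

End TestMaps.

Theorem corollary1 (R : realType) (n : nat) (hn : (0 < n)%N)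
  (T : GX R[i] n -> GX R[i] n)
  (TK : forall Phi : GX R[i] n, T (T Phi) = Phi)
  (Tfix : forall Phi : GX R[i] n,
    (GY R[i] n (\val Phi) -> T Phi = Phi) /\
    (~ GY R[i] n (\val Phi) -> T Phi <> Phi))
  (TF : exists F : 'rV[R[i]]_(n + 1 + n) -> 'rV[R[i]]_(n + 1 + n),
    holomorphic F /\
    forall Phi : GX R[i] n, \val (T Phi) = F \o \val Phi) :
  forall Phi : GX R[i] n, T Phi = legendre Phi.
Proof.
case: TF => F [hF TFE] Phi.
have FGX (Psi : 'rV[R[i]]_n -> 'rV[R[i]]_(n + 1 + n)) :
    GX R[i] n Psi -> GX R[i] n (F \o Psi).
  by move=> h; have := set_valP (T (GX_element h)); rewrite TFE.
have one0 : (1 : R[i]) != 0 by rewrite oner_neq0.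
(* Every point p is the value at 0 of an element of GX. *)
have FK p : F (F p) = p.
  have := f_equal (fun P => \val P 0) (TK (GX_element (Psi_scalar_GX p one0))).
  by rewrite !TFE /= Psi0.
have Fc := contact_of_preserves hF FGX.
(* The single map x -> (x, x.x/2, x) of GY runs through all of Y. *)
have Ffix (t : 'rV[R[i]]_n) :
    F (triple t (2^-1 * dot t t) t) = triple t (2^-1 * dot t t) t.
  have := proj1 (Tfix (GX_element (Psi_scalar_GX 0 one0))) (diagonal_GY R n).
  move=> /(f_equal (fun P => \val P t)); rewrite TFE /=.
  rewrite /Psi !mulmx1 /tpart /apart /bpart !raddf0 !add0r !mxE.
  by rewrite dot0l !add0r.
(* If F were the identity, T would fix x -> (x, x.x, 2x), which is outside GY because its theta-part
   and b-part differ. *)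
have Fne : exists p, F p <> p.
  apply: contrapT => /forallNP H.
  have two0 : (2 : R[i]) != 0 by rewrite pnatr_eq0.
  pose P : GX R[i] n := GX_element (Psi_scalar_GX 0 two0).
  have nGY : ~ GY R[i] n (\val P).
    move=> [_ [t [_ PE]]].
    have PEx := f_equal (fun f => f (const_mx 1)) PE.
    have := f_equal (@tpart R n) PEx; have := f_equal (@bpart R n) PEx.
    rewrite /= /Psi !tripleE /tpart /bpart !raddf0 !add0r mulmx1 => <-.
    rewrite mul_mx_scalar => /matrixP/(_ ord0 (Ordinal hn)); rewrite !mxE.
    move=> h; have : (1 : R[i]) = 0; last by apply/eqP.
    by apply: (@addrI _ (1 : R[i])); rewrite addr0 [RHS]h mulr1.
  have TP : T P = P.
    by apply: val_inj; rewrite TFE; apply/funext => x /=; apply: contrapT; exact: H.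
  exact: proj2 (Tfix P) nGY TP.
apply: val_inj; rewrite TFE; apply/funext => x /=.
rewrite (contact_involution_legendre hn hF FK Fc FGX Ffix Fne).
by [].
Qed.
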